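(* Let $G$ be an H-type group and let $\sigma\in\mathcal A_0$. Then for each $\varepsilon>0$, $\mathrm{Op}_\varepsilon(\sigma)$ is bounded on $L^2(G)$. Moreover, there exists a constant $C>0$ such that $$\forall\sigma\in\mathcal A_0,\ \forall\varepsilon>0,\qquad \|\mathrm{Op}_\varepsilon(\sigma)\|_{\mathcal L(L^2(G))}\le C\,\|\sigma\|_{\mathcal A_0}.$$
   Context: **H-type group.** $G$ is a connected simply connected real Lie group whose Lie algebra decomposes as $\mathfrak g=\mathfrak v\oplus\mathfrak z$ with $[\mathfrak v,\mathfrak v]=\mathfrak z$ the centre of $\mathfrak g$, $\dim\mathfrak v=2d$, $\dim\mathfrak z=p$; inner products are fixed on $\mathfrak v$ and $\mathfrak z$; for $\lambda\in\mathfrak z^*$, the skew-symmetric form $B(\lambda)(U,V)=\lambda([U,V])$ on $\mathfrak v$, viewed in an orthonormal basis as an endomorphism of $\mathfrak v$, satisfies $B(\lambda)^2=-|\lambda|^2\mathrm{Id}_{\mathfrak v}$. $G$ is identified with $\mathfrak g$ by the exponential map $\mathrm{Exp}$; the group law is $\mathrm{Exp}(V+Z)\,\mathrm{Exp}(V'+Z')=\mathrm{Exp}(V+V'+Z+Z'+\frac12[V,V'])$, the Haar measure $dx$ is Lebesgue measure $dV\,dZ$, the dilations are $\delta_t\mathrm{Exp}(V+Z)=\mathrm{Exp}(tV+t^2Z)$, $t>0$, and $Q=2d+2p$. $\mathcal S(G)$ is the Schwartz space of $G\simeq\mathbb R^{2d+p}$. **Representations.** For $\lambda\in\mathfrak z^*\setminus\{0\}$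 fix an orthonormal basis $(P_1,\dots,P_d,Q_1,\dots,Q_d)$ of $\mathfrak v$ (depending on $\lambda$) in which $B(\lambda)(U,V)=|\lambda|\,U^tJV$, $J=\begin{pmatrix}0&\mathrm{Id}\\-\mathrm{Id}&0\end{pmatrix}$. For $x=\mathrm{Exp}(\sum_j p_jP_j+\sum_j q_jQ_j+Z)$, $\pi^\lambda$ acts on $\mathcal H_\lambda=L^2(\mathfrak p_\lambda)\simeq L^2(\mathbb R^d)$ by $\pi^\lambda_x\Phi(\xi)=\exp[i\lambda(Z)+\tfrac i2|\lambda|\,p\cdot q+i\sqrt{|\lambda|}\,\xi\cdot q]\,\Phi(\xi+\sqrt{|\lambda|}\,p).$ For $\omega\in\mathfrak v^*$, $\pi^{0,\omega}_{\mathrm{Exp}(V+Z)}=e^{i\omega(V)}$ on $\mathcal H_{(0,\omega)}=\mathbb C$. The dual $\widehat G$ is parametrised by $(\mathfrak z^*\setminus\{0\})\sqcup\mathfrak v^*$. The Fourier transform is $\mathcal F f(\pi)=\widehat f(\pi)=\int_Gf(x)\pi_x^*\,dx$; the Plancherel measure is $c_0|\lambda|^d d\lambda$, carried by $\mathfrak z^*\setminus\{0\}$ ($c_0>0$ a constant), and $f(x)=c_0\int\mathrm{Tr}(\pi^\lambda_x\mathcal Ff(\lambda))|\lambda|^dd\lambda$ for $f\in\mathcal S(G)$. **Symbols.** $\mathcal A_0$ is the set of fields $\sigma=\{\sigma(x,\pi):(x,\pi)\in G\times\widehat G\}$ of the form $\sigma(x,\pi)=\mathcal F\kappa_x(\pi)=\int_G\kappa_x(y)\pi_y^*\,dy$,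 where $x\mapsto\kappa_x$ is a smooth compactly supported map from $G$ to $\mathcal S(G)$; $\kappa_x$ is called the convolution kernel of $\sigma$. Its norm is $\|\sigma\|_{\mathcal A_0}=\int_G\sup_{x\in G}|\kappa_x(z)|\,dz$. **Quantization.** For $\varepsilon>0$ and $f\in\mathcal S(G)$, $$\mathrm{Op}_\varepsilon(\sigma)f(x)=c_0\int_{\widehat G}\mathrm{Tr}\left(\pi^\lambda_x\,\sigma(x,\varepsilon^2\lambda)\,\mathcal Ff(\lambda)\right)|\lambda|^d\,d\lambda=\int_G f(y)\,\varepsilon^{-Q}\kappa_x(\delta_{\varepsilon^{-1}}(y^{-1}x))\,dy .$$ Boundedness on $L^2(G)$ means that this operator extends boundedly from $\mathcal S(G)$. *)

(* Defs.v *)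
From HB Require Import structures.
From mathcomp Require Import all_boot all_order all_algebra.
From mathcomp Require Import all_classical all_reals all_analysis.
From mathcomp Require Import complex ring lra.
Set Implicit Arguments. Unset Strict Implicit. Unset Printing Implicit Defensive.
Import Order.TTheory GRing.Theory Num.Theory.
Import numFieldNormedType.Exports.
Local Open Scope classical_set_scope.
Local Open Scope ring_scope.

Definition rv_display : measure_display -> measure_display.
Proof. exact. Qed.

Section rv_measurable.
Context {d} {T : measurableType d} (n : nat).

Let coord (i : 'I_n) (x : 'rV[T]_n) : T := x ord0 i.

Let rv_set0 : g_sigma_preimage coord set0.
Proof. exact: sigma_algebra0. Qed.

Let rv_setC A : g_sigma_preimage coord A -> g_sigma_preimage coord (~` A).
Proof. exact: sigma_algebraC. Qed.

Let rv_bigcup (F : _^nat) : (forall i, g_sigma_preimage coord (F i)) ->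
  g_sigma_preimage coord (\bigcup_i F i).
Proof. exact: sigma_algebra_bigcup. Qed.

HB.instance Definition _ := @isMeasurable.Build (rv_display d)
  'rV[T]_n (g_sigma_preimage coord) rv_set0 rv_setC rv_bigcup.

End rv_measurable.

Section rv_measurable_fun.
Context {d d'} {T : measurableType d} {T' : measurableType d'}.

Lemma measurable_coord n (i : 'I_n) :
  measurable_fun [set: 'rV[T]_n] (fun x : 'rV[T]_n => x ord0 i).
Proof.
move=> _ Y mY; rewrite setTI; apply: sub_sigma_algebra => /=.
rewrite -bigcup_seq/=; exists i => /=; first by rewrite mem_index_enum.
by exists Y => //; rewrite setTI.
Qed.

Lemma measurable_fun_rv n (f : T' -> 'rV[T]_n) :
  (forall i, measurable_fun [set: T'] (fun x => f x ord0 i)) ->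
  measurable_fun [set: T'] f.
Proof.
move=> mf _ A mA.
have : g_sigma_preimage (fun i => (fun x : 'rV[T]_n => x ord0 i) \o f)
    `<=` measurable.
  apply: smallest_sub; first exact: sigma_algebra_measurable.
  case: n => [|n] in f mf A mA *; first by rewrite big_ord0.
  rewrite -bigcup_mkord_ord; apply: bigcup_sub => i Ii.
  by move=> B [D mD <-]; exact: mf.
by rewrite g_sigma_preimage_comp; apply; exists A.
Qed.
End rv_measurable_fun.

(* The library's product measure has a sigma-finite structure only for
   sub-probabilities, hence this alias. *)
Section prod_sigma_finite.
Context d1 d2 (T1 : measurableType d1) (T2 : measurableType d2) (R : realType).
Variable m1 : {sigma_finite_measure set T1 -> \bar R}.
Variable m2 : {sigma_finite_measure set T2 -> \bar R}.

Definition prodm : set (T1 * T2) -> \bar R := (m1 \x m2)%E.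

HB.instance Definition _ := Measure.on prodm.

Let prodm_sigma_finite : sigma_finite setT prodm.
Proof.
have /sigma_finiteP[F [TF ndF Foo]] := sigma_finiteT m1.
have /sigma_finiteP[G [TG ndG Goo]] := sigma_finiteT m2.
exists (fun n => F n `*` G n).
  rewrite -setXTT TF TG predeqE => -[x y]; split.
    move=> [/= [n _ Fnx] [k _ Gky]]; exists (maxn n k) => //; split.
    - by move: x Fnx; exact/subsetPset/ndF/leq_maxl.
    - by move: y Gky; exact/subsetPset/ndG/leq_maxr.
  by move=> [n _ []/= ? ?]; split; exists n.
move=> k; have [? ?] := Foo k; have [? ?] := Goo k.
split; first exact: measurableX.
by rewrite /prodm product_measure1E// lte_mul_pinfty// ge0_fin_numE.
Qed.

HB.instance Definition _ := Measure_isSigmaFinite.Build _ _ _ prodm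
  prodm_sigma_finite.

End prod_sigma_finite.

Section lebesgue_rv.
Context {R : realType}.

Definition rv_cons n (x : measurableTypeR R * 'rV[R]_n) : 'rV[R]_n.+1 :=
  row_mx (x.1%:M : 'rV[R]_1) x.2.

Definition rv_uncons n (x : 'rV[R]_n.+1) : measurableTypeR R * 'rV[R]_n :=
  (x ord0 ord0, \row_i x ord0 (lift ord0 i)).

Lemma rv_cons0 n x : @rv_cons n x ord0 ord0 = x.1.
Proof.
have -> : @ord0 n = lshift n (@ord0 0) by exact/val_inj.
by rewrite /rv_cons (row_mxEl (x.1%:M : 'rV[R]_1) x.2 ord0 (@ord0 0)) mxE.
Qed.

Lemma rv_consS n x i : @rv_cons n x ord0 (lift ord0 i) = x.2 ord0 i.
Proof.
have -> : lift ord0 i = rshift 1 i by exact/val_inj.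
by rewrite /rv_cons (row_mxEr (x.1%:M : 'rV[R]_1) x.2 ord0 i).
Qed.

Lemma rv_consK n : cancel (@rv_cons n) (@rv_uncons n).
Proof.
move=> [x y]; rewrite /rv_uncons; congr pair; first by rewrite rv_cons0.
by apply/rowP => i; rewrite mxE rv_consS.
Qed.

Lemma rv_unconsK n : cancel (@rv_uncons n) (@rv_cons n).
Proof.
move=> x; apply/rowP => i; case: (unliftP ord0 i) => [j|] ->.
  by rewrite rv_consS mxE.
by rewrite rv_cons0.
Qed.

Lemma measurable_rv_cons n :
  measurable_fun [set: measurableTypeR R * 'rV[R]_n] (@rv_cons n).
Proof.
apply: measurable_fun_rv => i; case: (unliftP ord0 i) => [j|] ->.
- rewrite (_ : (fun x => _) = (fun y : 'rV[R]_n => y ord0 j) \o snd).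
    by apply: measurableT_comp => //; exact: (@measurable_coord _ R).
  by apply/funext => x; rewrite rv_consS.
- rewrite (_ : (fun x => _) = fst); first exact: measurable_fst.
  by apply/funext => x; rewrite rv_cons0.
Qed.

Lemma measurable_rv_uncons n :
  measurable_fun [set: 'rV[R]_n.+1] (@rv_uncons n).
Proof.
apply: measurable_fun_pair => /=; first exact: (@measurable_coord _ R).
apply: measurable_fun_rv => i.
rewrite (_ : (fun x => _) = (fun y : 'rV[R]_n.+1 => y ord0 (lift ord0 i))).
  exact: (@measurable_coord _ R).
by apply/funext => x; rewrite mxE.
Qed.

Section step.
Variables (n : nat) (m : {sigma_finite_measure set 'rV[R]_n -> \bar R}).

Definition lebesgue_rvS : set 'rV[R]_n.+1 -> \bar R :=
  pushforward (prodm (@lebesgue_measure R) m) (@rv_cons n).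

Let rvS0 : lebesgue_rvS set0 = 0%E.
Proof. by rewrite /lebesgue_rvS /pushforward preimage_set0 measure0. Qed.

Let rvS_ge0 A : (0 <= lebesgue_rvS A)%E.
Proof. by rewrite /lebesgue_rvS /pushforward measure_ge0. Qed.

Let rvS_sigma_additive : semi_sigma_additive lebesgue_rvS.
Proof.
move=> F mF tF mUF; rewrite /lebesgue_rvS /pushforward preimage_bigcup.
have mc := @measurable_rv_cons n.
apply: measure_semi_sigma_additive.
- by move=> k; rewrite -[X in measurable X]setTI; exact: mc.
- apply/trivIsetP => /= i j _ _ ij; rewrite -preimage_setI.
  by move/trivIsetP : tF => /(_ _ _ _ _ ij) ->//; rewrite preimage_set0.
- by rewrite -preimage_bigcup -[X in measurable X]setTI; exact: mc.
Qed.

HB.instance Definition _ := isMeasure.Build _ _ _ lebesgue_rvS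
  rvS0 rvS_ge0 rvS_sigma_additive.

Let rvS_sigma_finite : sigma_finite setT lebesgue_rvS.
Proof.
have [F FT mF] := sigma_finiteT (prodm (@lebesgue_measure R) m).
exists (fun k => @rv_uncons n @^-1` F k).
  by rewrite -preimage_bigcup -FT preimage_setT.
move=> k; have [mFk Fk] := mF k; split.
  by rewrite -[X in measurable X]setTI; exact: measurable_rv_uncons.
rewrite /lebesgue_rvS /pushforward -comp_preimage.
by rewrite (_ : _ \o _ = id)//; apply/funext => x; exact: rv_consK.
Qed.

HB.instance Definition _ := @Measure_isSigmaFinite.Build _ _ _ lebesgue_rvS
  rvS_sigma_finite.

End step.

Fixpoint lebesgue_rv n : {sigma_finite_measure set 'rV[R]_n -> \bar R} :=
  if n is k.+1 then [the {sigma_finite_measure set _ -> \bar _} of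
                     lebesgue_rvS (lebesgue_rv k)]
  else [the {sigma_finite_measure set _ -> \bar _} of @dirac _ 'rV[R]_0 0 R].

End lebesgue_rv.

Section complex_integration.
Context {dd} {T : measurableType dd} {R : realType}.
Variable mu : {measure set T -> \bar R}.
Local Notation C := R[i].
Implicit Types f g : T -> C.

Definition cmeasurable f :=
  measurable_fun setT (fun x => complex.Re (f x)) /\
  measurable_fun setT (fun x => complex.Im (f x)).

Definition cintegral (D : set T) f : C :=
  ((\int[mu]_(x in D) complex.Re (f x)) +i*
   (\int[mu]_(x in D) complex.Im (f x)))%C.

Definition L2norm f : \bar R := 
  Lnorm mu 2%:E (fun x => (Normc.normc (f x))%:E).

Definition L2 f := cmeasurable f /\ (L2norm f < +oo)%E.

Definition L2inner f g : C := cintegral setT (fun x => f x * conjc (g x)).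

Definition orthonormal_basis (e : nat -> T -> C) :=
  [/\ forall k, L2 (e k),
      forall j k, L2inner (e j) (e k) = (j == k)%:R
    & forall f, L2 f -> (forall k, L2inner f (e k) = 0) ->
        {ae mu, forall x, f x = 0}].

(* [t] is the sum of the diagonal of [A] in every orthonormal basis; on a
   separable infinite-dimensional space, for bounded [A], this happens exactly
   when [A] is trace class and [t] is its trace. *)
Definition is_trace (A : (T -> C) -> T -> C) (t : C) :=
  forall e, orthonormal_basis e ->
    series (fun k => complex.Re (L2inner (A (e k)) (e k))) @ \oo
      --> complex.Re t /\
    series (fun k => complex.Im (L2inner (A (e k)) (e k))) @ \oo
      --> complex.Im t.

Definition trace (A : (T -> C) -> T -> C) : C := xget 0 (is_trace A).

(* [A], given on the class [S] of functions, extends to a linear operator on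
   L^2, with norm at most [M]; elements of L^2 are functions up to a.e.
   equality. *)
Definition L2_bound (S : (T -> C) -> Prop) (A : (T -> C) -> T -> C) (M : R) :=
  0 <= M /\ exists B : (T -> C) -> T -> C,
    [/\ forall f, L2 f -> L2 (B f),
        forall (a : C) f g, L2 f -> L2 g ->
          {ae mu, forall x, B (fun y => a * f y + g y) x = a * B f x + B g x},
        forall f, L2 f -> (L2norm (B f) <= M%:E * L2norm f)%E
      & forall f, S f -> {ae mu, forall x, B f x = A f x}].

Definition L2_bounded S A := exists M, L2_bound S A M.

(* Equal to +oo if there is no bounded extension. *)
Definition L2_opnorm S A : \bar R := ereal_inf [set M%:E | M in L2_bound S A].

End complex_integration.

Section schwartz_space.
Context {R : realType} {E : normedModType R}.
Local Notation C := R[i].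
Implicit Types (f g : E -> C) (w : seq E).

Definition iter_derive w (h : E -> R) : E -> R := foldr (fun v k => 'D_v k) h w.

Definition smooth (h : E -> R) := forall w,
  (forall x v, derivable (iter_derive w h) x v) /\ continuous (iter_derive w h).

Definition iter_cderive w f : E -> C := fun x =>
  (iter_derive w (fun y => complex.Re (f y)) x +i*
   iter_derive w (fun y => complex.Im (f y)) x)%C.

Definition csmooth f :=
  smooth (fun x => complex.Re (f x)) /\ smooth (fun x => complex.Im (f x)).

(* The Schwartz seminorm of [f] of index [(N, w)] is at most [M]. *)
Definition seminorm_le (N : nat) w f (M : R) :=
  forall x, (1 + `|x|) ^+ N * Normc.normc (iter_cderive w f x) <= M.

Definition schwartz f :=
  csmooth f /\ forall N w, exists M, seminorm_le N w f M.

Definition schwartz_cvg {I : Type} (F : set_system I) (u : I -> E -> C) g :=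
  forall N w (e : R), 0 < e ->
    \forall i \near F, seminorm_le N w (fun x => u i x - g x) e.

(* [D w x] is the iterated derivative of [k] at [x] in the directions [w],
   for the Frechet topology of the Schwartz space. *)
Definition smooth_to_schwartz (k : E -> E -> C) :=
  exists D : seq E -> E -> E -> C,
  [/\ D [::] = k,
      forall w x, schwartz (D w x),
      forall w x, schwartz_cvg (nbhs x) (D w) (D w x)
    & forall w v x, schwartz_cvg (0 : R)^'
        (fun h z => (h^-1)%:C%C * (D w (x + h *: v) z - D w x z))
        (D (v :: w) x)].

Definition compactly_supported (k : E -> E -> C) :=
  exists2 K : set E, compact K & forall x, ~ K x -> forall z, k x z = 0.

End schwartz_space.

Section euclidean.
Context {R : realType} {n : nat}.

Definition dot (u v : 'rV[R]_n) : R := \sum_i u ord0 i * v ord0 i.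

Definition enorm (u : 'rV[R]_n) : R := Num.sqrt (dot u u).

Lemma dotE u v : dot u v = (u *m v^T) ord0 ord0.
Proof. by rewrite mxE; apply: eq_bigr => i _; rewrite mxE. Qed.

Lemma dotC u v : dot u v = dot v u.
Proof. by apply: eq_bigr => i _; rewrite mulrC. Qed.

Lemma dotDl u v w : dot (u + v) w = dot u w + dot v w.
Proof. by rewrite !dotE mulmxDl mxE. Qed.

Lemma dotDr u v w : dot u (v + w) = dot u v + dot u w.
Proof. by rewrite dotC dotDl !(dotC u). Qed.

Lemma dotZl (a : R) u v : dot (a *: u) v = a * dot u v.
Proof. by rewrite !dotE -scalemxAl mxE. Qed.

Lemma dotZr (a : R) u v : dot u (a *: v) = a * dot u v.
Proof. by rewrite dotC dotZl dotC. Qed.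

End euclidean.

(* An H-type Lie algebra v (+) z, with v and z identified with R^(2d) and R^p
   by orthonormal bases; a linear form on z is identified with the vector [l]
   such that it is [dot l].  The Lie bracket of V + Z and V' + Z' is
   [bracket V V'], so that z is central. *)
Record htype (R : realType) (d p : nat) := HType {
  bracket : 'rV[R]_(2 * d) -> 'rV[R]_(2 * d) -> 'rV[R]_p ;
  bracket_linearl : forall W, linear (fun U => bracket U W) ;
  bracket_linearr : forall U, linear (bracket U) ;
  bracket_alt : forall U, bracket U U = 0 ;
  bracket_span : forall Z, exists (k : nat) (U W : 'I_k -> 'rV[R]_(2 * d)),
    Z = \sum_i bracket (U i) (W i) ;
  bracket_center : forall U, (forall W, bracket U W = 0) -> U = 0 ;
  bracket_htype : forall l : 'rV[R]_p,
    let B : 'M[R]_(2 * d) :=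
      \matrix_(i, j) dot l (bracket (delta_mx ord0 i) (delta_mx ord0 j)) in
    B *m B = (- enorm l ^+ 2)%:M }.

Section htype_group.
Context {R : realType} {d p : nat} (G : htype R d p).
Local Notation V := 'rV[R]_(2 * d).
Local Notation Z := 'rV[R]_p.
Local Notation elt := (V * Z)%type.

Definition gmul (x y : elt) : elt :=
  (x.1 + y.1, x.2 + y.2 + 2^-1 *: bracket G x.1 y.1).

Definition ginv (x : elt) : elt := (- x.1, - x.2).

Definition haar : {sigma_finite_measure set elt -> \bar R} :=
  [the {sigma_finite_measure set elt -> \bar R} of
   prodm (lebesgue_rv (2 * d)) (lebesgue_rv p)].

(* The bases (P_j, Q_j) of v attached to the nonzero linear forms l on z.
   They are the same for l and t *: l, t > 0: this is what makes the operators
   sigma(x, eps^2 l) and F f(l) act on the same space. *)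
Record polarization := Polarization {
  basP : Z -> 'I_d -> V ;
  basQ : Z -> 'I_d -> V ;
  coordPQ := fun (l : Z) (U : V) =>
    row_mx (\row_j dot U (basP l j)) (\row_j dot U (basQ l j)) ;
  bas_orthonormal : forall l i j, l != 0 ->
    [/\ dot (basP l i) (basP l j) = (i == j)%:R,
        dot (basQ l i) (basQ l j) = (i == j)%:R
      & dot (basP l i) (basQ l j) = 0] ;
  bas_bracket : forall l U W, l != 0 ->
    let J : 'M[R]_(d + d) := block_mx 0 1%:M (- 1%:M) 0 in
    dot l (bracket G U W) =
      enorm l * (coordPQ l U *m J *m (coordPQ l W)^T) ord0 ord0 ;
  bas_ray : forall l (t : R), l != 0 -> 0 < t ->
    basP (t *: l) = basP l /\ basQ (t *: l) = basQ l }.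

End htype_group.

Section representations.
Context {R : realType} {d p : nat} {G : htype R d p} (PQ : polarization G).
Local Notation C := R[i].
Local Notation V := 'rV[R]_(2 * d).
Local Notation Z := 'rV[R]_p.
Local Notation elt := (V * Z)%type.

Definition cis (t : R) : C := (cos t +i* sin t)%C.

Inductive dual := Schrodinger of Z | Character of V.

Definition in_dual (pi : dual) :=
  if pi is Schrodinger l then l != 0 else true.

(* Functions standing for their classes in L^2(R^d), respectively scalars. *)
Definition rep_space (pi : dual) : Type :=
  if pi is Schrodinger _ then 'rV[R]_d -> C else C.

Definition rep (pi : dual) (x : elt) : rep_space pi -> rep_space pi :=
  match pi return rep_space pi -> rep_space pi with
  | Schrodinger l => fun Phi xi =>
      let P := \row_j dot x.1 (basP PQ l j) in
      let Q := \row_j dot x.1 (basQ PQ l j) in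
      let s := Num.sqrt (enorm l) in
      cis (dot l x.2 + 2^-1 * enorm l * dot P Q + s * dot xi Q)
      * Phi (xi + s *: P)
  | Character om => fun c => cis (dot om x.1) * c
  end.

Lemma cisD s t : cis (s + t) = cis s * cis t.
Proof.
by apply/eqP; rewrite eq_complex /= cosD sinD; apply/andP; split; apply/eqP; ring.
Qed.

Lemma rep_gmul l x y : l != 0 ->
  rep (pi := Schrodinger l) (gmul G x y) =
  rep (pi := Schrodinger l) x \o rep (pi := Schrodinger l) y.
Proof.
move=> l0; apply/funext => Phi; apply/funext => xi /=.
pose P x := \row_j dot x (basP PQ l j) : 'rV[R]_d.
pose Q x := \row_j dot x (basQ PQ l j) : 'rV[R]_d.
have PD u v : P (u + v) = P u + P v by apply/rowP => j; rewrite !mxE dotDl.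
have QD u v : Q (u + v) = Q u + Q v by apply/rowP => j; rewrite !mxE dotDl.
have lE : dot l (bracket G x.1 y.1) =
    enorm l * (dot (P x.1) (Q y.1) - dot (Q x.1) (P y.1)).
  rewrite (bas_bracket PQ)// /coordPQ -/(P x.1) -/(Q x.1) -/(P y.1) -/(Q y.1).
  rewrite mul_row_block !mulmx0 mulmxN !mulmx1 add0r addr0.
  rewrite tr_row_mx mul_row_col mulNmx addrC !dotE; congr (_ * _).
  by rewrite [LHS]mxE; congr (_ + _); rewrite [LHS]mxE.
rewrite -/(P _) -/(Q _) -/(P x.1) -/(Q x.1) -/(P y.1) -/(Q y.1) PD QD.
rewrite scalerDr addrA mulrA -cisD; congr (cis _ * _).
rewrite !dotDr !dotDl !dotZl !dotZr lE (dotC (Q x.1)).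
have /(congr1 (fun z => z * dot (P x.1) (Q y.1))) /= :
  Num.sqrt (enorm l) * Num.sqrt (enorm l) = enorm l.
  by rewrite -expr2 sqr_sqrtr// sqrtr_ge0.
lra.
Qed.

(* The representations are unitary, so that the adjoint of [rep pi x] is
   [rep pi (ginv x)].  For f in the Schwartz space and Phi in L^2 the integral
   converges absolutely for every xi. *)
Definition fourier (f : elt -> C) (pi : dual) : rep_space pi -> rep_space pi :=
  match pi return rep_space pi -> rep_space pi with
  | Schrodinger l => fun Phi xi => cintegral (haar (d := d) (p := p)) setT
      (fun x => f x * rep (pi := Schrodinger l) (ginv x) Phi xi)
  | Character om => fun c => cintegral (haar (d := d) (p := p)) setT
      (fun x => f x * rep (pi := Character om) (ginv x) c)
  end.

Definition optrace (A : ('rV[R]_d -> C) -> 'rV[R]_d -> C) : C :=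
  trace (lebesgue_rv d) A.

(* Integral over the dual with respect to the Plancherel measure
   c0 |l|^d dl. *)
Definition plancherel_integral (c0 : R) (h : Z -> C) : C :=
  c0%:C%C * cintegral (lebesgue_rv p) (~` [set 0])
    (fun l => h l * (enorm l ^+ d)%:C%C).

(* [c0] is the constant of the Plancherel measure: the Fourier inversion
   formula holds on the Schwartz space. *)
Definition plancherel_constant (c0 : R) :=
  0 < c0 /\ forall f : elt -> C, schwartz f -> forall x,
    f x = plancherel_integral c0 (fun l => optrace (fun Phi =>
            rep (pi := Schrodinger l) x (fourier f (pi := Schrodinger l) Phi))).

Definition symbol := elt -> forall pi : dual, rep_space pi -> rep_space pi.

Definition convolution_kernel (sigma : symbol) (k : elt -> elt -> C) :=
  [/\ smooth_to_schwartz k, compactly_supported k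
    & forall x pi, in_dual pi -> sigma x pi = fourier (k x) (pi := pi)].

Definition A0 (sigma : symbol) := exists k, convolution_kernel sigma k.

(* The norm in A0 of the symbol with convolution kernel [k]. *)
Definition A0_norm (k : elt -> elt -> C) : \bar R :=
  (\int[haar (d := d) (p := p)]_z
     ereal_sup [set (Normc.normc (k x z))%:E | x in [set: elt]])%E.

Definition Op (c0 eps : R) (sigma : symbol) (f : elt -> C) : elt -> C :=
  fun x => plancherel_integral c0 (fun l => optrace (fun Phi =>
    rep (pi := Schrodinger l) x
      (sigma x (Schrodinger (eps ^+ 2 *: l))
        (fourier f (pi := Schrodinger l) Phi)))).

End representations.

(* Main.v *)
(** Write [x / z] for the group element [x * delta_eps(z)^-1].
    Substituting in the Fourier integrals, and using that
    [pi^(eps^2 l)_x = pi^l_(delta_eps x)], one gets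
    [sigma(x, eps^2 l) o F f(l) = F g_x(l)] where
    [g_x(w) = int kappa_x(z) f(w / z) dz] is again a Schwartz function.  Fourier
    inversion for [g_x], evaluated at [x], gives
    [Op_eps(sigma) f(x) = int kappa_x(z) f(x / z) dz].
    If [M(z) = sup_x |kappa_x(z)|], Cauchy-Schwarz yields
    [|Op_eps(sigma) f(x)|^2 <= |M|_1 * int M(z) |f(x / z)|^2 dz]; integrating in
    [x], right invariance of the Haar measure bounds the operator norm by
    [|M|_1], so that the constant 1 is suitable. *)
Require Import Defs.
From mathcomp Require Import all_boot all_order all_algebra.
From mathcomp Require Import all_classical all_reals all_analysis measurable_realfun.
From mathcomp Require Import complex ring lra.
Set Implicit Arguments. Unset Strict Implicit. Unset Printing Implicit Defensive.
Import Order.TTheory GRing.Theory Num.Theory.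
Import numFieldNormedType.Exports.
Local Open Scope classical_set_scope.
Local Open Scope ring_scope.

(** * Lebesgue measure on row vectors *)

(** No trace is ever computed: [plancherel_constant] supplies inversion on Schwartz functions, and
    two Plancherel integrals of traces are compared integrand by integrand. The work lies in three
    obstacles. That [g_x] is Schwartz: derivatives in [w] fall on [f] alone, and since [w / z] has a
    linear part affine in [z], they only bring out factors of linear growth in [z], absorbed by the
    decay of [kappa_x]. Smoothness being expressed by directional derivatives, linearity in the
    direction and a uniform Taylor bound have to be derived first. That the operators agree:
    elements of L^2 are actual functions, and the Fourier integral of a square-integrable [Phi] may
    diverge at some [xi]. The identity therefore holds for almost every [xi], and traces are
    compared through inner products, which ignore null sets. That everything is measurable: the
    sigma-algebra on row vectors is generated by the coordinates, whereas Schwartz functions are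
    continuous for the norm. Rounding to finer and finer grids links the two; it also makes the
    supremum [M], taken over an uncountable set, measurable. *)

Section measure_preserving.
Context {d} {T : measurableType d} {R : realType} (mu : {measure set T -> \bar R}).
Local Open Scope ereal_scope.

(** Phrased with integrals of nonnegative functions rather than measures of sets: this is what
    iterated integrals yield and what changes of variable consume. Indicator functions give back the
    statement on sets. *)
Definition measure_preserving (phi : T -> T) :=
  measurable_fun [set: T] phi /\
  forall f : T -> \bar R, measurable_fun [set: T] f -> (forall x, 0 <= f x) ->
    \int[mu]_x f (phi x) = \int[mu]_x f x.

Lemma measure_preserving_integral (phi : T -> T) (f : T -> \bar R) :
  measure_preserving phi -> measurable_fun [set: T] f ->
  \int[mu]_x f (phi x) = \int[mu]_x f x.
Proof.
move=> [mphi h] mf; rewrite integralE [RHS]integralE.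
rewrite -(h (f^\+) (measurable_funepos mf))// -(h (f^\-) (measurable_funeneg mf))//.
by congr (_ - _); apply: eq_integral => x _; rewrite (funepos_comp, funeneg_comp).
Qed.

End measure_preserving.

Section prodm_theory.
Context d1 d2 (T1 : measurableType d1) (T2 : measurableType d2) (R : realType).
Variable m1 : {sigma_finite_measure set T1 -> \bar R}.
Variable m2 : {sigma_finite_measure set T2 -> \bar R}.
Local Open Scope ereal_scope.

Lemma prodm_tonelli1 (f : T1 * T2 -> \bar R) :
  measurable_fun [set: T1 * T2] f -> (forall x, 0 <= f x) ->
  \int[prodm m1 m2]_z f z = \int[m1]_x \int[m2]_y f (x, y).
Proof. exact: fubini_tonelli1. Qed.

Lemma measurable_integral2 (f : T1 * T2 -> \bar R) :
  measurable_fun [set: T1 * T2] f -> (forall x, 0 <= f x) ->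
  measurable_fun [set: T1] (fun x => \int[m2]_y f (x, y)).
Proof. exact: measurable_fun_fubini_tonelli_F. Qed.

End prodm_theory.

Lemma tonelli_swap d1 d2 (T1 : measurableType d1) (T2 : measurableType d2) (R : realType)
    (m1 : {sigma_finite_measure set T1 -> \bar R})
    (m2 : {sigma_finite_measure set T2 -> \bar R}) (f : T1 -> T2 -> \bar R) :
  measurable_fun [set: T1 * T2] (fun z => f z.1 z.2) -> (forall x y, (0 <= f x y)%E) ->
  (\int[m1]_x \int[m2]_y f x y = \int[m2]_y \int[m1]_x f x y)%E.
Proof. by move=> mf f0; exact: (@fubini_tonelli _ _ T1 T2 R m1 m2
  (fun z => f z.1 z.2) mf (fun z => f0 z.1 z.2)). Qed.

Section lebesgue_rv_theory.
Context {R : realType}.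
Local Open Scope ereal_scope.

(** The image of Lebesgue measure by the translation gives every half-open interval its length, so
    uniqueness of Lebesgue measure identifies the two. *)
Lemma lebesgue_measure_translation (a : R) :
  measure_preserving (@lebesgue_measure R) (fun x => x + a)%R.
Proof.
have ma : measurable_fun [set: measurableTypeR R]
    (fun x : measurableTypeR R => x + a : measurableTypeR R)%R.
  by apply: (@measurable_funD _ (measurableTypeR R) R).
split => // f mf f0.
rewrite -[LHS](@ge0_integral_pushforward _ _ _ _ _ _ ma lebesgue_measure setT f)//.
apply: eq_measure_integral => //= A mA _; apply/esym.
apply: (lebesgue_measure_unique _ mA) => _ [[b c]] _ <-.
rewrite [RHS](_ : _ = lebesgue_measure `](b - a)%R, (c - a)%R]%classic); last first.
  congr (lebesgue_measure _); apply/seteqP; split => x /=.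
    by rewrite !in_itv/= ltrBlDr lerBrDr.
  by rewrite !in_itv/= ltrBlDr lerBrDr.
rewrite !lebesgue_measure_itv/= !lte_fin ltrD2r -!EFinD.
by rewrite opprD opprK addrACA addNr addr0.
Qed.

Lemma integral_lebesgue_rvS n (f : 'rV[R]_n.+1 -> \bar R) :
  measurable_fun [set: _] f -> (forall x, 0 <= f x) ->
  \int[lebesgue_rv n.+1]_x f x =
  \int[lebesgue_measure]_a \int[lebesgue_rv n]_x f (rv_cons (a, x)).
Proof.
move=> mf f0; rewrite /= /lebesgue_rvS ge0_integral_pushforward//; last first.
  exact: measurable_rv_cons.
rewrite preimage_setT prodm_tonelli1 => [//||x]; last exact: f0.
exact: measurableT_comp (@measurable_rv_cons _ _).
Qed.

Lemma measurable_rv_add n : measurable_fun [set: _]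
  (fun x : 'rV[R]_n * 'rV[R]_n => x.1 + x.2)%R.
Proof.
apply: measurable_fun_rv => i.
rewrite (_ : (fun x => _) = (fun x : 'rV[R]_n * 'rV[R]_n => x.1 ord0 i + x.2 ord0 i)%R).
  apply: (@measurable_funD _ _ R).
  - exact: measurableT_comp (@measurable_coord _ R n i) measurable_fst.
  - exact: measurableT_comp (@measurable_coord _ R n i) measurable_snd.
by apply/funext => x; rewrite mxE.
Qed.

Lemma measurable_fun_rvD {d'} {T' : measurableType d'} n (f g : T' -> 'rV[R]_n) :
  measurable_fun [set: _] f -> measurable_fun [set: _] g ->
  measurable_fun [set: _] (fun x => f x + g x)%R.
Proof.
by move=> mf mg; exact: measurableT_comp (@measurable_rv_add n) (measurable_fun_pair mf mg).
Qed.

(** Induction on the dimension, splitting off the first coordinate by Tonelli. In dimension 0 there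
    is only one point. *)
Lemma lebesgue_rv_translation n (v : 'rV[R]_n) :
  measure_preserving (lebesgue_rv n) (fun x => x + v)%R.
Proof.
elim: n v => [|n IH] v.
  split => [|f mf f0]; first by apply: measurable_fun_rvD.
  by apply: eq_integral => x _; congr f; apply/rowP => -[].
have mv : measurable_fun [set: _] (fun x : 'rV[R]_n.+1 => x + v)%R.
  exact: measurable_fun_rvD.
split => // f mf f0; rewrite integral_lebesgue_rvS;
  [|exact: (measurableT_comp mf mv)|by move=> x; exact: f0].
rewrite integral_lebesgue_rvS; [|exact: mf|exact: f0].
have [a [w ->]] : exists a w, v = rv_cons (a, w).
  by exists (rv_uncons v).1, (rv_uncons v).2; 
  rewrite -[LHS](rv_unconsK v) [in LHS](surjective_pairing (rv_uncons v)).
have consD b x : (rv_cons (b, x) + rv_cons (a, w) = rv_cons (b + a, x + w)%R)%R.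
  apply/rowP => i; rewrite mxE; case: (unliftP ord0 i) => [j|] ->.
  - by rewrite !rv_consS/= mxE.
  - by rewrite !rv_cons0.
have mfc : measurable_fun [set: _] (f \o @rv_cons R n).
  exact: measurableT_comp (@measurable_rv_cons _ _).
transitivity (\int[lebesgue_measure]_b \int[lebesgue_rv n]_x f (rv_cons (b + a, x)%R)).
  apply: eq_integral => b _; rewrite -[RHS](IH w).2//.
  - by apply: eq_integral => x _; rewrite consD.
  - exact: (measurableT_comp mfc (pair1_measurable _)).
apply: ((lebesgue_measure_translation a).2
  (fun b => \int[lebesgue_rv n]_x f (rv_cons (b, x)))).
- apply: (measurable_integral2 (lebesgue_rv n) mfc) => ?; exact: f0.
- by move=> x; exact: integral_ge0.
Qed.

(** With the first component fixed, the second undergoes a plain translation; a translation of the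
    first remains. Right multiplication in the group has exactly this form, because the bracket
    depends on the first components only. *)
Lemma lebesgue_rv_shear m n (u : 'rV[R]_m) (h : 'rV[R]_m -> 'rV[R]_n) :
  measurable_fun [set: 'rV[R]_m] h ->
  measure_preserving (prodm (lebesgue_rv m) (lebesgue_rv n))
    (fun z => (z.1 + u, z.2 + h z.1))%R.
Proof.
move=> mh.
have ms : measurable_fun [set: 'rV[R]_m * 'rV[R]_n]
    (fun z : 'rV[R]_m * 'rV[R]_n => (z.1 + u, z.2 + h z.1))%R.
  apply: measurable_fun_pair => /=.
    exact: measurable_fun_rvD measurable_fst (measurable_cst _).
  exact: measurable_fun_rvD measurable_snd (measurableT_comp mh measurable_fst).
split => // f mf f0; rewrite prodm_tonelli1; last 2 first.
- exact: (measurableT_comp mf ms).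
- by move=> z; exact: f0.
rewrite prodm_tonelli1; [|exact: mf|exact: f0].
transitivity (\int[lebesgue_rv m]_x \int[lebesgue_rv n]_y f ((x + u)%R, y)).
  apply: eq_integral => x _.
  apply: ((lebesgue_rv_translation (h x)).2 (fun y => f ((x + u)%R, y))) => //.
  exact: (measurableT_comp mf (pair1_measurable _)).
apply: ((lebesgue_rv_translation u).2
  (fun x => \int[lebesgue_rv n]_y f (x, y))).
- exact: (measurable_integral2 (lebesgue_rv n) mf f0).
- by move=> x; exact: integral_ge0.
Qed.

End lebesgue_rv_theory.

(** * Continuous functions are measurable *)

Section rv_norm.
Context {R : realType}.

Lemma rv_coord_le n (x : 'rV[R]_n) i : `|x ord0 i| <= `|x|.
Proof.
rewrite [leRHS]/Num.Def.normr/= mx_normrE.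
exact: (le_bigmax _ (fun ij : 'I_1 * 'I_n => `|x ij.1 ij.2|) (ord0, i)).
Qed.

Lemma rv_norm_le n (x : 'rV[R]_n) (e : R) :
  0 <= e -> (forall i, `|x ord0 i| <= e) -> `|x| <= e.
Proof.
move=> e0 h; rewrite [leLHS]/Num.Def.normr/= mx_normrE.
by apply: (bigmax_le _ e0) => -[i j] _ /=; rewrite (ord1 i) h.
Qed.

End rv_norm.

Section discretizable.
Context {d} {T : measurableType d} {U : topologicalType}.

(* [i x] is the limit of [i (r n (e n x))], where [e n] takes countably many
   values; [i] identifies the measurable space with the topological one. *)
Definition discretizable (i : T -> U) :=
  exists (e : nat -> T -> nat) (r : nat -> nat -> T),
    (forall n k, measurable [set x | e n x = k]) /\
    (forall x, i (r n (e n x)) @[n --> \oo] --> i x).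

(** The approximations of [f \o i] are constant on countably many measurable cells, hence
    measurable, and continuity of [f] makes them converge pointwise. *)
Lemma discretizable_measurable {R : realType} (i : T -> U) (f : U -> R) :
  discretizable i -> continuous f -> measurable_fun [set: T] (f \o i).
Proof.
move=> [e [r [me er]]] cf.
apply: (@measurable_fun_cvg _ _ _ _ (fun n x => f (i (r n (e n x))))); last first.
  by move=> x _; exact: (continuous_cvg _ (cf (i x)) (er x)).
move=> n _ Y mY; rewrite setTI.
rewrite (_ : _ @^-1` _ =
  \bigcup_(k in [set k | Y (f (i (r n k)))]) [set x | e n x = k]).
  by apply: bigcup_measurable => k _; exact: me.
apply/seteqP; split => x /=.
- by move=> Yx; exists (e n x).
- by move=> [k /= Yk ->].
Qed.

(** By continuity in the first variable, the supremum does not change when restricted to the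
    countably many representatives [r n k], which [D] enumerates. *)
Lemma measurable_sup_discretizable {R : realType} d' (T' : measurableType d')
    (i : T -> U) (g : U -> T' -> R) :
  discretizable i ->
  (forall z, continuous (g^~ z)) -> (forall x, measurable_fun [set: T'] (g x)) ->
  measurable_fun [set: T'] (fun z => ereal_sup [set (g (i x) z)%:E | x in [set: T]]).
Proof.
move=> [e [r [_ er]]] cg mg.
pose D (m : nat) : T := if unpickle m is Some (n, k) then r n k else r 0%N 0%N.
rewrite (_ : (fun z => _) = (fun z => esups (fun m => (g (i (D m)) z)%:E) 0%N)).
  by apply: measurable_fun_esups => m; apply/measurable_EFinP; exact: mg.
apply/funext => z; apply/eqP; rewrite eq_le; apply/andP; split; last first.
  apply: ereal_sup_le => _ [m _ <-] /=; by exists (D m).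
apply: ge_ereal_sup => _ [x _ <-].
have gx : (g (i (r n (e n x))) z)%:E @[n --> \oo] --> (g (i x) z)%:E.
  apply: cvg_EFin; first exact: nearW.
  have h := continuous_cvg _ (cg z (i x)) (er x).
  exact: (h _).
apply: (cvge_to_le gx); apply: nearW => n; apply: ereal_sup_ubound.
by exists (pickle (n, e n x)) => //; rewrite /D pickleK.
Qed.

End discretizable.

(** A pair of cell indices is coded by one natural number through [pickle]; a number that codes no
    pair has an empty cell. *)
Lemma discretizable_prod d1 d2 (T1 : measurableType d1) (T2 : measurableType d2)
    (U1 U2 : topologicalType) (i1 : T1 -> U1) (i2 : T2 -> U2) :
  discretizable i1 -> discretizable i2 ->
  discretizable (fun x : T1 * T2 => (i1 x.1, i2 x.2) : U1 * U2).
Proof.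
move=> [e1 [r1 [me1 er1]]] [e2 [r2 [me2 er2]]].
exists (fun n x => pickle (e1 n x.1, e2 n x.2)).
exists (fun n k => if unpickle k is Some (k1, k2) then (r1 n k1, r2 n k2)
                   else (r1 n 0%N, r2 n 0%N)).
split => [n k|x]; last first.
  under eq_fun do rewrite pickleK; exact: (cvg_pair (er1 x.1) (er2 x.2)).
have [[[k1 k2] <-]|nk] := pselect (exists kk : nat * nat, pickle kk = k).
  rewrite (_ : [set x | _] = [set x | e1 n x = k1] `*` [set x | e2 n x = k2]).
    exact: measurableX.
  apply/seteqP; split => -[x y] /=; last by move=> [-> ->].
  by move/(pcan_inj pickleK) => -[].
rewrite (_ : [set x | _] = set0)//; apply/seteqP; split => // -[x y] /= xk.
by apply: nk; exists (e1 n x, e2 n y).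
Qed.

Section discretizable_rv.
Context {R : realType}.

Lemma measurable_floorE (k : int) : measurable [set x : R | Num.floor x = k].
Proof.
rewrite (_ : [set x | _] = `[k%:~R, (k + 1)%:~R[%classic) //.
apply/seteqP; split => x /=; rewrite in_itv/=.
  by move=> <-; exact: floor_itv.
by move=> h; exact: floor_def.
Qed.

(** Each coordinate is rounded down to the grid of mesh [1 / m.+1]. Grid points are given by integer
    vectors, hence countable; the cells are boxes, and the error is at most the mesh. *)
Lemma discretizable_rv n : discretizable (fun x : 'rV[R]_n => x).
Proof.
pose q m (x : R) : int := Num.floor (x * m.+1%:R).
exists (fun m (x : 'rV[R]_n) => pickle (\row_i q m (x ord0 i) : 'rV[int]_n)).
exists (fun m k => if unpickle k is Some M then
  \row_i (((M : 'rV[int]_n) ord0 i)%:~R / m.+1%:R) else (0 : 'rV[R]_n)).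
split => [m k|x]; last first.
  under eq_fun do rewrite pickleK.
  apply/cvgrPdist_le => /= e e0; near=> m.
  have m0 : 0 < m.+1%:R :> R by [].
  apply: rv_norm_le; first exact: ltW.
  move=> i; rewrite !mxE /q.
  have /andP[h1 h2] := floor_itv (x ord0 i * m.+1%:R).
  rewrite -(ler_pM2r m0) -[X in _ * X <= _](gtr0_norm m0) -normrM mulrBl mulfVK ?gt_eqF//.
  rewrite ger0_norm ?subr_ge0//.
  rewrite intrD in h2.
  apply: (@le_trans _ _ 1); first by rewrite lerBlDl ltW.
  rewrite -ler_pdivrMl// mulr1; near: m.
  exists (Num.truncn e^-1) => // m /= hm; apply: ltW.
  by apply: (lt_le_trans (truncnS_gt _)); rewrite ler_nat ltnS.
have [[M <-]|nk] := pselect (exists M : 'rV[int]_n, pickle M = k).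
  rewrite (_ : [set x | _] =
    \bigcap_(i in [set: 'I_n]) [set x : 'rV[R]_n | q m (x ord0 i) = M ord0 i]).
    apply: fin_bigcap_measurable => // i _.
    have mi : measurable_fun [set: 'rV[R]_n] (fun x : 'rV[R]_n => x ord0 i * m.+1%:R).
      by apply: (@measurable_funM _ _ R) => //; exact: measurable_coord.
    by have := mi measurableT _ (measurable_floorE (M ord0 i)); rewrite setTI.
  apply/seteqP; split => x /=.
    by move/(pcan_inj pickleK) => /rowP xM i _ /=; rewrite -(xM i) mxE.
  by move=> h; congr pickle; apply/rowP => i; rewrite mxE; exact: h.
rewrite (_ : [set x | _] = set0)//; apply/seteqP; split => // x /= xk.
by apply: nk; exists (\row_i q m (x ord0 i)).
Unshelve. all: by end_near. Qed.

End discretizable_rv.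

(** * Integrability of rapidly decreasing functions *)

Section decay.
Context {R : realType}.

(** A product of one-variable densities, so that its integral factors by Tonelli, which that of a
    power of [1 + |x|] would not. *)
Definition decay_weight n (x : 'rV[R]_n) : R := \prod_i (oneDsqr (x ord0 i))^-1.

Lemma decay_weight_ge0 n (x : 'rV[R]_n) : 0 <= decay_weight x.
Proof. by apply: prodr_ge0 => i _; rewrite invr_ge0. Qed.

Lemma measurable_decay_weight n : measurable_fun [set: 'rV[R]_n] (@decay_weight n).
Proof.
apply: (@measurable_prod _ _ R) => i _.
have mo : measurable_fun [set: R] (fun x : R => (oneDsqr x)^-1).
  by apply: continuous_measurable_fun; exact: continuous_oneDsqrV.
exact: (measurableT_comp mo (@measurable_coord _ R n i)).
Qed.

Lemma integral_decay_weight1 :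
  (\int[lebesgue_measure]_x (oneDsqr (x : R))^-1%:E = pi%:E)%E.
Proof.
rewrite (ge0_symfun_integralT (f := fun x => (oneDsqr x)^-1)).
- rewrite -set_itvcy integral0y_oneDsqr -EFinM; congr (_%:E).
  by rewrite mulrCA mulfV ?mulr1.
- by move=> x; rewrite invr_ge0.
- exact: continuous_oneDsqrV.
- by move=> x /=; rewrite /oneDsqr sqrrN.
Qed.

Lemma integral_decay_weight n :
  (\int[lebesgue_rv n]_x (decay_weight x)%:E = (pi ^+ n)%:E)%E.
Proof.
have mE k : measurable_fun [set: 'rV[R]_k] (fun x => (decay_weight x)%:E).
  by apply/measurable_EFinP; exact: measurable_decay_weight.
elim: n => [|n IH].
  rewrite [LHS](integral_dirac (0 : 'rV[R]_0) measurableT (mE 0%N)).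
  by rewrite diracT mul1e /decay_weight big_ord0.
rewrite integral_lebesgue_rvS//; last by move=> x; rewrite lee_fin decay_weight_ge0.
transitivity (\int[lebesgue_measure]_a (((oneDsqr (a : R))^-1)%:E * (pi ^+ n)%:E))%E.
  apply: eq_integral => a _; rewrite -IH -ge0_integralZl_EFin//.
  - apply: eq_integral => x _; rewrite -EFinM; congr (_%:E).
    rewrite /decay_weight big_ord_recl rv_cons0; congr (_ * _).
    by apply: eq_bigr => i _; rewrite rv_consS.
  - by move=> x _; rewrite lee_fin decay_weight_ge0.
  - exact: mE.
rewrite ge0_integralZr//.
- by rewrite integral_decay_weight1 -EFinM exprS.
- apply/measurable_EFinP; apply: continuous_measurable_fun.
  exact: continuous_oneDsqrV.
- by rewrite lee_fin exprn_ge0// pi_ge0.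
Qed.

(** The norm is the sup norm, so each of the [n] factors [1 + x_i^2] is at most [(1 + |x|)^2]. *)
Lemma decay_weight_ge n (x : 'rV[R]_n) : ((1 + `|x|) ^+ (2 * n))^-1 <= decay_weight x.
Proof.
rewrite /decay_weight prodfV lef_pV2 ?posrE; last 2 first.
- by rewrite exprn_gt0// ltr_pwDl.
- by apply: prodr_gt0 => i _; rewrite (lt_le_trans ltr01).
rewrite exprM -[X in _ <= _ ^+ X]card_ord -prodr_const.
apply: ler_prod => i _; rewrite (le_trans ler01)//=.
rewrite /oneDsqr sqrrD expr1n mul1r -addrA lerD2l.
rewrite (@le_trans _ _ (`|x| ^+ 2))//; last by rewrite lerDr mulrn_wge0.
by rewrite -[leLHS]real_normK ?num_real// lerXn2r ?nnegrE// rv_coord_le.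
Qed.

End decay.

(** * Directional derivatives *)

Section difference_quotient.
Context {R : realType} {E : normedModType R}.
Implicit Types (f : E -> R) (x v : E).

Lemma is_derive_quotient f x v (D : R) :
  (fun t => t^-1 * (f (t *: v + x) - f x)) t @[t --> 0^'] --> D ->
  is_derive x v f D.
Proof. by move=> H; split; [apply/cvg_ex; exists D | exact: cvg_lim H]. Qed.

Lemma derivable_quotient f x v : derivable f x v ->
  (fun t => t^-1 * (f (t *: v + x) - f x)) t @[t --> 0^'] --> 'D_v f x.
Proof. by []. Qed.

(** A remainder bound valid for every [t] survives integration in a parameter; this is how
    differentiation under the integral sign is carried out, in place of dominated convergence. *)
Lemma is_derive_quadratic f x v (D K : R) :
  (forall t, `|f (t *: v + x) - f x - t * D| <= K * t ^+ 2) ->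
  is_derive x v f D.
Proof.
move=> HK; apply: is_derive_quotient; apply/cvgrPdist_le => /= e e0.
have K0 : 0 <= K by have := le_trans (normr_ge0 _) (HK 1); rewrite expr1n mulr1.
have K1 : 0 < K + 1 by rewrite ltr_wpDl.
near=> t.
have t0 : t != 0 by near: t; exact: nbhs_dnbhs_neq.
have tn0 : 0 < `|t| by rewrite normr_gt0.
rewrite -(ler_pM2l tn0) -normrM mulrBr mulrA mulfV// mul1r -normrN opprB.
apply: (le_trans (HK t)).
rewrite -real_normK ?num_real// expr2 mulrCA ler_pM2l//.
apply: (@le_trans _ _ ((K + 1) * `|t|)); first by rewrite ler_wpM2r// lerDl.
rewrite mulrC -ler_pdivlMr//; near: t.
apply/nbhs_dnbhs; apply/nbhs_normP; exists (e / (K + 1)) => /=.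
  by rewrite divr_gt0.
by move=> t /=; rewrite sub0r normrN => /ltW.
Unshelve. all: by end_near. Qed.

End difference_quotient.

Section directional_derivative.
Context {R : realType} {E : normedModType R}.
Implicit Types (h : E -> R) (x u v : E).

Lemma is_derive_line h v : (forall x, derivable h x v) ->
  forall x t, is_derive t (1 : R) (fun t => h (t *: v + x)) ('D_v h (t *: v + x)).
Proof.
move=> dh x t; apply: is_derive_quotient.
have := derivable_quotient (dh (t *: v + x)).
apply: cvg_trans; apply: near_eq_cvg; apply: nearW => s.
by congr (_ * (h _ - h _)); rewrite [s *: 1]mulr1 scalerDl addrA.
Qed.

Lemma mvt_line h v : (forall x, derivable h x v) -> forall x,
  exists2 c : R, 0 <= c <= 1 & h (v + x) - h x = 'D_v h (c *: v + x).
Proof.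
move=> dh x; have [||c] := @MVT_segment R (fun t => h (t *: v + x))
  (fun t => 'D_v h (t *: v + x)) 0 1 ler01.
- by move=> t _; exact: is_derive_line.
- apply: derivable_within_continuous => t _.
  by have [] := is_derive_line dh x t.
by rewrite in_itv/= => c01; rewrite scale1r scale0r add0r subr0 mulr1; exists c.
Qed.

(** The quotient along [a *: v] at [t] is [a] times the quotient along [v] at [a * t]. The case
    [a = 0] is apart, since [a * t] would leave the punctured neighbourhood. *)
Lemma deriveZdir h v (a : R) : (forall x, derivable h x v) -> forall x,
  'D_(a *: v) h x = a * 'D_v h x.
Proof.
move=> dh x.
suff : is_derive x (a *: v) h (a * 'D_v h x) by case.
have [->|a0] := eqVneq a 0.
  rewrite scale0r mul0r; apply: is_derive_quadratic (0 : R) _ => t.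
  by rewrite scaler0 add0r subrr mulr0 subr0 normr0 mul0r.
apply: is_derive_quotient.
have H := derivable_quotient (dh x).
have : (fun t => a * ((a * t)^-1 * (h ((a * t) *: v + x) - h x))) t @[t --> 0^']
    --> a * 'D_v h x.
  apply: cvgM; first exact: cvg_cst.
  apply: (cvg_comp (fun t => a * t) (fun t => t^-1 * (h (t *: v + x) - h x))) H.
  move=> P; rewrite /nbhs/= => -[e /= e0 eP]; exists (e / `|a|) => /=.
    by rewrite divr_gt0// normr_gt0.
  move=> t /=; rewrite !sub0r !normrN => te t0; apply: eP => /=.
    by rewrite sub0r normrN normrM mulrC -ltr_pdivlMr// normr_gt0.
  by rewrite mulf_neq0.
apply: cvg_trans; apply: near_eq_cvg; apply: nearW => t /=.
by rewrite invfM mulrA mulrA mulfV// mul1r scalerA mulrC [t * a]mulrC mulrC.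
Qed.

(** Directional derivatives need not be additive in the direction; continuity makes them so. The
    increment is split into a step along [u] followed by a step along [v]; the mean value theorem
    turns the second into a value of ['D_v h] at a point that tends to [x]. *)
Lemma deriveDdir h u v :
  (forall x w, derivable h x w) -> (forall w, continuous ('D_w h)) ->
  forall x, 'D_(u + v) h x = 'D_u h x + 'D_v h x.
Proof.
move=> dh ch x.
suff : is_derive x (u + v) h ('D_u h x + 'D_v h x) by case.
apply: is_derive_quotient.
have Hu := derivable_quotient (dh x u).
suff Hv : (fun t => t^-1 * (h (t *: v + (t *: u + x)) - h (t *: u + x))) t
    @[t --> 0^'] --> 'D_v h x.
  apply: cvg_trans (cvgD Hu Hv); apply: near_eq_cvg; apply: nearW => t /=.
  have -> : t *: (u + v) + x = t *: v + (t *: u + x).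
    by rewrite scalerDr addrA [t *: v + _]addrC.
  by rewrite -mulrDr; congr (_ * _); rewrite [LHS]addrC addrA subrK.
apply/cvgrPdist_le => /= e e0.
have /cvgrPdist_le/(_ _ e0)/nbhs_normP[d /= d0 hd] := ch v x.
near=> t.
have t0 : t != 0 by near: t; exact: nbhs_dnbhs_neq.
have [c /andP[c0 c1] ->] := @mvt_line h (t *: v) (fun x => dh x _) (t *: u + x).
rewrite (deriveZdir _ (dh^~ v)) mulrA (mulVf t0) mul1r.
apply: hd => /=; rewrite -normrN opprB addrA addrK scalerA.
apply: (le_lt_trans (ler_normD _ _)).
rewrite !normrZ (ger0_norm c0).
apply: (@le_lt_trans _ _ (`|t| * (`|u| + `|v|))).
  by rewrite mulrDr addrC lerD2l ler_wpM2r// ler_piMl.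
have uv0 : 0 < `|u| + `|v| + 1 by rewrite ltr_wpDl// addr_ge0.
apply: (@le_lt_trans _ _ (`|t| * (`|u| + `|v| + 1))).
  by rewrite ler_wpM2l// lerDl.
rewrite -ltr_pdivlMr//; near: t.
apply/nbhs_dnbhs; apply/nbhs_normP; exists (d / (`|u| + `|v| + 1)) => /=.
  by rewrite divr_gt0.
by move=> t /=; rewrite sub0r normrN.
Unshelve. all: by end_near. Qed.

Lemma derive_sumdir h (I : finType) (c : I -> R) (e : I -> E) :
  (forall x w, derivable h x w) -> (forall w, continuous ('D_w h)) ->
  forall x, 'D_(\sum_i c i *: e i) h x = \sum_i c i * 'D_(e i) h x.
Proof.
move=> dh ch x.
rewrite (big_morph (fun v => 'D_v h x) (id1 := 0) (op1 := +%R)).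
- by apply: eq_bigr => i _; exact: deriveZdir.
- by move=> u v; exact: deriveDdir.
- by have := @deriveZdir h 0 0 (dh^~ 0) x; rewrite scale0r mul0r.
Qed.

End directional_derivative.

(** * Rapid decay and integrability on a product of two Euclidean spaces *)

Section rapidly_decreasing.
Context {R : realType}.

Definition rapidly_decreasing {E : normedModType R} (b : E -> R) :=
  forall N, exists M, forall z, (1 + `|z|) ^+ N * `|b z| <= M.

Lemma rapidly_decreasing_le {E : normedModType R} (a b : E -> R) :
  rapidly_decreasing b -> (forall z, `|a z| <= `|b z|) -> rapidly_decreasing a.
Proof.
move=> rb ab N; have [M hM] := rb N; exists M => z.
by apply: le_trans (hM z); rewrite ler_wpM2l// exprn_ge0// addr_ge0.
Qed.

Lemma rapidly_decreasingD {E : normedModType R} (a b : E -> R) :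
  rapidly_decreasing a -> rapidly_decreasing b -> rapidly_decreasing (a \+ b).
Proof.
move=> ra rb N; have [M hM] := ra N; have [M' hM'] := rb N; exists (M + M') => z.
apply: le_trans (lerD (hM z) (hM' z)); rewrite -mulrDr ler_wpM2l//.
exact: ler_normD.
Qed.

Lemma rapidly_decreasing_mul_poly {E : normedModType R} (a b : E -> R) (K : R) k :
  rapidly_decreasing b -> (forall z, `|a z| <= K * (1 + `|z|) ^+ k) ->
  rapidly_decreasing (fun z => b z * a z).
Proof.
move=> rb ha N; have [M hM] := rb (N + k)%N; exists (K * M) => z.
have K0 : 0 <= K.
  have := le_trans (normr_ge0 _) (ha 0).
  by rewrite normr0 addr0 expr1n mulr1.
apply: le_trans (ler_wpM2l K0 (hM z)).
rewrite normrM exprD.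
have h1 : 0 <= (1 + `|z|) ^+ N * `|b z| by rewrite mulr_ge0// exprn_ge0// addr_ge0.
have := ler_wpM2l h1 (ha z); set x := _ ^+ N; set y := _ ^+ k.
move=> h; apply: le_trans (le_trans _ h) _;
  by rewrite le_eqVlt; apply/orP; left; apply/eqP; ring.
Qed.

Lemma rapidly_decreasing_bounded {E : normedModType R} (b : E -> R) :
  rapidly_decreasing b -> exists M, forall z, `|b z| <= M.
Proof.
by move=> rb; have [M hM] := rb 0%N; exists M => z; have := hM z; rewrite expr0 mul1r.
Qed.

Variables m n : nat.
Local Notation E := ('rV[R]_m * 'rV[R]_n)%type.
Local Notation mu := (prodm (lebesgue_rv m) (lebesgue_rv n)).

(** Decay of order [2 * m + 2 * n] dominates [|b|] by [M] times the product of the two weights, by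
    [decay_weight_ge] on each component; that product has integral [pi ^+ (m + n)]. *)
Lemma rapidly_decreasing_integrable (b : E -> R) :
  measurable_fun [set: E] b -> rapidly_decreasing b ->
  mu.-integrable [set: E] (EFin \o b).
Proof.
move=> mb rb; have [M hM] := rb (2 * m + 2 * n)%N.
have M0 : 0 <= M.
  by apply: le_trans (hM 0); rewrite mulr_ge0// exprn_ge0// addr_ge0.
have mw : measurable_fun [set: E]
    (fun z : E => (M * (decay_weight z.1 * decay_weight z.2))%:E).
  apply/measurable_EFinP; apply: measurable_funM => //; apply: measurable_funM.
    exact: measurableT_comp (@measurable_decay_weight _ m) measurable_fst.
  exact: measurableT_comp (@measurable_decay_weight _ n) measurable_snd.
have w0 (z : E) : (0 <= (M * (decay_weight z.1 * decay_weight z.2))%:E)%E.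
  by rewrite lee_fin mulr_ge0// mulr_ge0// decay_weight_ge0.
have mdw k : measurable_fun [set: 'rV[R]_k] (fun x => (decay_weight x)%:E).
  by apply/measurable_EFinP; exact: measurable_decay_weight.
have pw k : 0 <= pi ^+ k :> R by rewrite exprn_ge0// pi_ge0.
apply: (@le_integrable _ _ _ mu _ measurableT _
    (fun z : E => (M * (decay_weight z.1 * decay_weight z.2))%:E)).
- exact/measurable_EFinP.
- move=> z _ /=; rewrite lee_fin [leRHS]ger0_norm; last by have := w0 z; rewrite lee_fin.
  have h0 : 0 < (1 + `|z|) ^+ (2 * m + 2 * n) by rewrite exprn_gt0// ltr_pwDl.
  have hh k (x : 'rV[R]_k) : `|x| <= `|z| -> ((1 + `|z|) ^+ (2 * k))^-1 <= decay_weight x.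
    move=> xz; apply: le_trans (decay_weight_ge x).
    rewrite lef_pV2 ?posrE ?exprn_gt0 ?ltr_pwDl//.
    by rewrite lerXn2r ?nnegrE ?addr_ge0// lerD2l.
  apply: (@le_trans _ _ (M / (1 + `|z|) ^+ (2 * m + 2 * n))).
    by rewrite ler_pdivlMr// mulrC hM.
  rewrite ler_wpM2l// exprD invfM ler_pM ?invr_ge0 ?exprn_ge0 ?addr_ge0//.
    by apply: hh; rewrite prod_normE le_max lexx.
  by apply: hh; rewrite prod_normE le_max lexx orbT.
apply/integrableP; split => //.
under eq_integral => z _ do rewrite gee0_abs//.
rewrite (prodm_tonelli1 _ _ mw w0).
rewrite (eq_integral (fun x : 'rV[R]_m => ((M * pi ^+ n)%:E * (decay_weight x)%:E)%E)).
  rewrite ge0_integralZl_EFin//; last 3 first.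
  - by move=> x _; rewrite lee_fin decay_weight_ge0.
  - exact: mdw.
  - by rewrite mulr_ge0.
  by rewrite integral_decay_weight ltry.
move=> x _ /=.
under eq_integral => y _ do rewrite mulrA EFinM.
rewrite ge0_integralZl_EFin//; last 3 first.
- by move=> y _; rewrite lee_fin decay_weight_ge0.
- exact: mdw.
- by rewrite mulr_ge0// decay_weight_ge0.
rewrite integral_decay_weight -!EFinM; congr (_%:E); ring.
Qed.

Lemma continuous_measurable_fun_rv2 (f : E -> R) :
  continuous f -> measurable_fun [set: E] f.
Proof.
move=> cf; have := discretizable_measurable
  (discretizable_prod (discretizable_rv m) (discretizable_rv n)) cf.
by apply: eq_measurable_fun => -[x y].
Qed.

End rapidly_decreasing.

(** * Schwartz functions *)

Section real_schwartz.
Context {R : realType} {E : normedModType R}.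
Implicit Types h : E -> R.

Definition real_schwartz h :=
  smooth h /\ forall w, rapidly_decreasing (iter_derive w h).

Lemma real_schwartz_derive h v : real_schwartz h -> real_schwartz ('D_v h).
Proof.
have rE w : iter_derive w ('D_v h) = iter_derive (rcons w v) h.
  by rewrite /iter_derive foldr_rcons.
by move=> [sh rh]; split => w; rewrite rE; [exact: sh|exact: rh].
Qed.

Lemma real_schwartz_derivable h : real_schwartz h -> forall x v, derivable h x v.
Proof. by move=> [sh _]; have [] := sh [::]. Qed.

Lemma real_schwartz_continuous h : real_schwartz h -> continuous h.
Proof. by move=> [sh _]; have [] := sh [::]. Qed.

Lemma real_schwartz_rapid h : real_schwartz h -> rapidly_decreasing h.
Proof. by move=> [_ rh]; exact: (rh [::]). Qed.

(** A coinduction principle: a class stable under directional derivatives has to be controlled at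
    order zero only, since iterated derivatives stay in it. *)
Lemma real_schwartz_ind (P : (E -> R) -> Prop) :
  (forall f, P f -> [/\ forall x v, derivable f x v, continuous f,
      rapidly_decreasing f & forall v, P ('D_v f)]) ->
  forall f, P f -> real_schwartz f.
Proof.
move=> HP f Pf; have Pw w : P (iter_derive w f).
  by elim: w => //= v w /HP[].
by split => w; have [] := HP _ (Pw w).
Qed.

End real_schwartz.
Arguments real_schwartz_derivable {R E h} sh x v : rename.

Section rv2_schwartz.
Context {R : realType} {m n : nat}.
Local Notation E := ('rV[R]_m * 'rV[R]_n)%type.
Implicit Types h : E -> R.

Definition rv2_basis (k : 'I_m + 'I_n) : E :=
  match k with inl i => (delta_mx ord0 i, 0) | inr j => (0, delta_mx ord0 j) end.

Definition rv2_coord (k : 'I_m + 'I_n) (v : E) : R :=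
  match k with inl i => v.1 ord0 i | inr j => v.2 ord0 j end.

Lemma rv2_basisE v : v = \sum_k rv2_coord k v *: rv2_basis k.
Proof.
have sum1 (I : finType) (F : I -> E) : (\sum_i F i).1 = \sum_i (F i).1.
  exact: (big_morph fst).
have sum2 (I : finType) (F : I -> E) : (\sum_i F i).2 = \sum_i (F i).2.
  exact: (big_morph snd).
rewrite big_sumType /= [LHS]surjective_pairing; apply/pair_equal_spec; split => /=.
- rewrite !sum1/= [X in _ + X]big1 ?addr0; last by move=> j _; rewrite scaler0.
  exact: row_sum_delta.
- rewrite !sum2/= [X in X + _]big1 ?add0r; last by move=> j _; rewrite scaler0.
  exact: row_sum_delta.
Qed.

Lemma rv2_coord_le k v : `|rv2_coord k v| <= `|v|.
Proof.
rewrite prod_normE le_max.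
by case: k => i /=; rewrite rv_coord_le ?orbT.
Qed.

Lemma real_schwartz_deriveE h v x : real_schwartz h ->
  'D_v h x = \sum_k rv2_coord k v * 'D_(rv2_basis k) h x.
Proof.
move=> sh; rewrite {1}(rv2_basisE v) derive_sumdir//.
- exact: real_schwartz_derivable.
- by move=> w; apply: real_schwartz_continuous; exact: real_schwartz_derive.
Qed.

Lemma real_schwartz_derive_bound h : real_schwartz h ->
  exists2 M, 0 <= M & forall x v, `|'D_v h x| <= M * `|v|.
Proof.
move=> sh.
have /choice[M hM] : forall k, exists M, forall x, `|'D_(rv2_basis k) h x| <= M.
  by move=> k; apply/rapidly_decreasing_bounded/real_schwartz_rapid/real_schwartz_derive.
exists (\sum_k M k).
  by apply: sumr_ge0 => k _; exact: le_trans (hM k 0).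
move=> x v; rewrite real_schwartz_deriveE// mulr_suml.
apply: (le_trans (ler_norm_sum _ _ _)); apply: ler_sum => k _.
by rewrite normrM mulrC ler_pM// rv2_coord_le.
Qed.

Lemma real_schwartz_lipschitz h : real_schwartz h ->
  exists2 M, 0 <= M & forall x v, `|h (v + x) - h x| <= M * `|v|.
Proof.
move=> sh; have [M M0 hM] := real_schwartz_derive_bound sh; exists M => // x v.
have [c _ ->] := mvt_line (fun x => real_schwartz_derivable sh x v) x.
exact: hM.
Qed.

(** By the mean value theorem the remainder is the variation of ['D_v h] between [x] and
    [c *: v + x]. Expanding [v] in the basis gives one factor [|v|]; the Lipschitz bounds of the
    finitely many basis derivatives give the other. *)
Lemma real_schwartz_taylor h : real_schwartz h ->
  exists2 M, 0 <= M & forall x v, `|h (v + x) - h x - 'D_v h x| <= M * `|v| ^+ 2.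
Proof.
move=> sh.
have /choice[M hM] : forall k, exists M, 0 <= M /\
    forall x v, `|'D_(rv2_basis k) h (v + x) - 'D_(rv2_basis k) h x| <= M * `|v|.
  move=> k.
  have [M M0 hM] := real_schwartz_lipschitz (real_schwartz_derive (rv2_basis k) sh).
  by exists M.
exists (\sum_k M k); first by apply: sumr_ge0 => k _; exact: (hM k).1.
move=> x v.
have [c /andP[c0 c1] ->] := mvt_line (fun x => real_schwartz_derivable sh x v) x.
rewrite !(real_schwartz_deriveE v _ sh) -sumrB mulr_suml.
apply: (le_trans (ler_norm_sum _ _ _)); apply: ler_sum => k _.
rewrite -mulrBr normrM expr2 mulrCA; apply: ler_pM => //.
  exact: rv2_coord_le.
apply: (le_trans ((hM k).2 _ _)); rewrite normrZ ger0_norm//.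
by rewrite ler_wpM2l ?(hM k).1// ler_piMl.
Qed.

End rv2_schwartz.

(** * Convolutions *)

Lemma eq_integrableT {d} {T : measurableType d} {R : realType}
    (mu : {measure set T -> \bar R}) (f g : T -> \bar R) :
  mu.-integrable [set: T] f -> f =1 g -> mu.-integrable [set: T] g.
Proof. by move=> + /funext <-. Qed.

Lemma Rintegral_sum {d} {T : measurableType d} {R : realType}
    (mu : {measure set T -> \bar R}) (I : Type) (s : seq I) (f : I -> T -> R) :
  (forall i, mu.-integrable [set: T] (EFin \o f i)) ->
  mu.-integrable [set: T] (EFin \o (fun x => \sum_(i <- s) f i x)) /\
  \int[mu]_x (\sum_(i <- s) f i x) = \sum_(i <- s) \int[mu]_x f i x.
Proof.
move=> intf; elim: s => [|i s [ints IH]].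
  rewrite big_nil; split.
    apply: (@eq_integrableT _ _ _ _ (cst 0%E)); first exact: integrable0.
    by move=> x /=; rewrite big_nil.
  under eq_Rintegral => x _ do rewrite big_nil.
  by rewrite Rintegral_cst// mul0r.
rewrite big_cons -IH; split.
  apply: (eq_integrableT (integrableD measurableT (intf i) ints)) => x /=.
  by rewrite big_cons EFinD.
by rewrite -RintegralD//; apply: eq_Rintegral => x _; rewrite big_cons.
Qed.

Lemma lipschitz_continuous {R : realType} {E W : normedModType R} (f : E -> W) (L : R) :
  (forall x v, `|f (v + x) - f x| <= L * `|v|) -> continuous f.
Proof.
move=> fL x; apply/cvgrPdist_le => /= e e0.
have L1 : 0 < `|L| + 1 by rewrite ltr_wpDl.
near=> y; rewrite -normrN opprB -[y in f y](subrK x).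
apply: (le_trans (fL _ _)); apply: (@le_trans _ _ ((`|L| + 1) * `|y - x|)).
  by rewrite ler_wpM2r// (le_trans (ler_norm L))// lerDl.
rewrite mulrC -ler_pdivlMr//; near: y; apply/nbhs_normP.
exists (e / (`|L| + 1)) => /=; first by rewrite divr_gt0.
by move=> y /=; rewrite -normrN opprB => /ltW.
Unshelve. all: by end_near. Qed.

Section twisted_convolution.
Context {R : realType} {m n : nat}.
Local Notation E := ('rV[R]_m * 'rV[R]_n)%type.
Local Notation mu := (prodm (lebesgue_rv m) (lebesgue_rv n)).
Implicit Types a b : E -> R.

(** Weaker than Schwartz on purpose: derivatives of a convolution never fall on the density, and the
    class is stable under the polynomially growing factors that they bring out. *)
Definition rapid_density b := continuous b /\ rapidly_decreasing b.

Lemma rapid_densityM b (p : E -> R) (K : R) k :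
  rapid_density b -> continuous p -> (forall z, `|p z| <= K * (1 + `|z|) ^+ k) ->
  rapid_density (fun z => b z * p z).
Proof.
move=> [cb rb] cp pK; split; last exact: rapidly_decreasing_mul_poly pK.
by move=> z; apply: cvgM; [exact: cb|exact: cp].
Qed.

Lemma rapid_density_integrable b : rapid_density b ->
  mu.-integrable [set: E] (EFin \o b).
Proof.
move=> [cb rb]; apply: rapidly_decreasing_integrable => //.
exact: continuous_measurable_fun_rv2.
Qed.

Definition moment b k : R := \int[mu]_z (`|b z| * (1 + `|z|) ^+ k).

Lemma continuous_weight k : continuous (fun z : E => (1 + `|z|) ^+ k).
Proof.
move=> z; apply: (@continuous_comp _ _ _ (fun z : E => 1 + `|z|) (fun x : R => x ^+ k)).
  by apply: cvgD; [exact: cvg_cst|exact: norm_continuous].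
exact: exprn_continuous.
Qed.

Lemma moment_integrable b k : rapid_density b ->
  mu.-integrable [set: E] (EFin \o (fun z => `|b z| * (1 + `|z|) ^+ k)).
Proof.
move=> [cb rb]; apply: rapid_density_integrable.
apply: (@rapid_densityM (fun z => `|b z|) _ 1 k).
- split; first by move=> z; apply: cvg_norm; exact: cb.
  by apply: rapidly_decreasing_le rb _ => z; rewrite normr_id.
- exact: continuous_weight.
- by move=> z; rewrite mul1r ger0_norm.
Qed.

Lemma Rintegral_mul_le b (F : E -> R) (C : R) k :
  rapid_density b -> continuous F -> (forall z, `|F z| <= C * (1 + `|z|) ^+ k) ->
  `|\int[mu]_z (b z * F z)| <= C * moment b k.
Proof.
move=> gb cF FC.
have gbF := rapid_densityM gb cF FC.
apply: (le_trans (le_normr_Rintegral measurableT (rapid_density_integrable gbF))).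
rewrite /moment -RintegralZl//; last exact: moment_integrable.
apply: le_Rintegral => //.
- exact: integrable_norm (rapid_density_integrable gbF).
- exact: (eq_integrableT (integrableZl measurableT C (moment_integrable k gb))).
- by move=> z _; rewrite normrM mulrCA ler_wpM2l.
Qed.

(* [act z] is affine with linear part [lin z]; in the application
   [act z w = w * delta_eps(z)^-1]. *)
Context (act lin : E -> E -> E) (K : R).
Context (actD : forall z w v, act z (v + w) = lin z v + act z w).
Context (linZ : forall z (t : R) v, lin z (t *: v) = t *: lin z v).
Context (lin_le : forall z v, `|lin z v| <= K * (1 + `|z|) * `|v|).
Context (act_le : forall z w, 1 + `|w| <= K * (1 + `|act z w|) * (1 + `|z|) ^+ 2).
Context (act_cont : forall w, continuous (act^~ w)).
Context (lin_cont : forall v, continuous (lin^~ v)).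

Lemma K_ge0 : 0 <= K.
Proof.
have := le_trans _ (act_le 0 0); rewrite !normr0 !addr0 !expr1n !mulr1 => /(_ _ ler01).
by rewrite pmulr_lge0// ltr_pwDl.
Qed.

Definition conv b a (w : E) : R := \int[mu]_z (b z * a (act z w)).

Lemma act_comp_continuous a w : continuous a -> continuous (fun z => a (act z w)).
Proof. by move=> ca z; apply: continuous_comp; [exact: act_cont|exact: ca]. Qed.

Lemma conv_integrable b a w : rapid_density b -> real_schwartz a ->
  mu.-integrable [set: E] (EFin \o (fun z => b z * a (act z w))).
Proof.
move=> gb sa; have [M hM] := rapidly_decreasing_bounded (real_schwartz_rapid sa).
apply: rapid_density_integrable; apply: (@rapid_densityM _ _ M 0) => //.
  exact/act_comp_continuous/real_schwartz_continuous.
by move=> z; rewrite expr0 mulr1.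
Qed.

Lemma lin_coord_continuous v k : continuous (fun z => rv2_coord k (lin z v)).
Proof.
move=> z; case: k => i /=.
- apply: (@continuous_comp _ _ _ (fun z => (lin z v).1) (fun x => x ord0 i)).
    by apply: continuous_comp; [exact: lin_cont|exact: cvg_fst].
  exact: coord_continuous.
- apply: (@continuous_comp _ _ _ (fun z => (lin z v).2) (fun x => x ord0 i)).
    by apply: continuous_comp; [exact: lin_cont|exact: cvg_snd].
  exact: coord_continuous.
Qed.

Lemma rapid_density_lin b v k : rapid_density b ->
  rapid_density (fun z => b z * rv2_coord k (lin z v)).
Proof.
move=> gb; apply: (@rapid_densityM _ _ (K * `|v|) 1) => //.
  exact: lin_coord_continuous.
move=> z; rewrite expr1 mulrAC; exact: le_trans (rv2_coord_le _ _) (lin_le _ _).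
Qed.

(** The Taylor remainder of [a] at [act z w] in the direction [lin z (t *: v)] is at most
    [M * (|t| * K * (1 + |z|) * |v|) ^+ 2]. Integrated against [|b|], it is quadratic in [t], with
    the second moment of [b] in the constant. *)
Lemma is_derive_conv b a w v : rapid_density b -> real_schwartz a ->
  is_derive w v (conv b a)
    (\sum_k conv (fun z => b z * rv2_coord k (lin z v)) ('D_(rv2_basis k) a) w).
Proof.
move=> gb sa; have [M M0 hM] := real_schwartz_taylor sa.
apply: (@is_derive_quadratic _ _ _ _ _ _ (M * (K * `|v|) ^+ 2 * moment b 2)) => t.
have sD k := real_schwartz_derive (rv2_basis k) sa.
have intD k := conv_integrable w (rapid_density_lin v k gb) (sD k).
have [iS <-] := Rintegral_sum (index_enum _) intD.
have iZ : mu.-integrable [set: E] (EFin \o (fun z => t * \sum_k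
    (b z * rv2_coord k (lin z v) * 'D_(rv2_basis k) a (act z w)))).
  exact: (eq_integrableT (integrableZl measurableT t iS)).
rewrite -RintegralZl// /conv -!RintegralB//; last first.
- exact: conv_integrable.
- exact: conv_integrable.
- exact: (eq_integrableT (integrableB measurableT (conv_integrable (t *: v + w) gb sa)
    (conv_integrable w gb sa))).
pose F z := a (act z (t *: v + w)) - a (act z w) - 'D_(lin z (t *: v)) a (act z w).
have FE z : b z * a (act z (t *: v + w)) - b z * a (act z w) -
   t * \sum_k (b z * rv2_coord k (lin z v) * 'D_(rv2_basis k) a (act z w)) = b z * F z.
  rewrite /F !mulrBr; congr (_ - _).
  rewrite linZ deriveZdir ?real_schwartz_deriveE//; last first.
    by move=> x; exact: real_schwartz_derivable.
  rewrite !mulr_sumr; apply: eq_bigr => k _; ring.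
under eq_Rintegral => z _ do rewrite FE.
rewrite [leRHS](_ : _ = (M * (t * (K * `|v|)) ^+ 2) * moment b 2); last by ring.
apply: Rintegral_mul_le => //.
- move=> z; rewrite /F; apply: cvgB; first apply: cvgB.
  + exact: (act_comp_continuous (real_schwartz_continuous sa)).
  + exact: (act_comp_continuous (real_schwartz_continuous sa)).
  + under eq_fun do rewrite real_schwartz_deriveE//.
    rewrite (real_schwartz_deriveE _ _ sa).
    apply: (cvg_big (op := +%R)); first exact: add_continuous.
    move=> k _; apply: cvgM; first exact: lin_coord_continuous.
    exact: (act_comp_continuous (real_schwartz_continuous (sD k))).
- move=> z; rewrite /F actD; apply: (le_trans (hM _ _)).
  rewrite -mulrA ler_wpM2l// -exprMn linZ normrZ.
  rewrite [leRHS](_ : _ = (`|t| * (K * (1 + `|z|) * `|v|)) ^+ 2); last first.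
    by rewrite !exprMn real_normK ?num_real//; ring.
  by rewrite lerXn2r ?nnegrE ?mulr_ge0 ?K_ge0// ler_wpM2l.
Qed.

Lemma conv_lipschitz b a : rapid_density b -> real_schwartz a ->
  exists L, forall w v, `|conv b a (v + w) - conv b a w| <= L * `|v|.
Proof.
move=> gb sa; have [M M0 hM] := real_schwartz_lipschitz sa.
exists (M * K * moment b 1) => w v.
rewrite /conv -RintegralB//; [|exact: conv_integrable..].
under eq_Rintegral => z _ do rewrite -mulrBr.
rewrite [leRHS](_ : _ = M * K * `|v| * moment b 1); last by ring.
apply: Rintegral_mul_le => //.
- by move=> z; apply: cvgB; exact: (act_comp_continuous (real_schwartz_continuous sa)).
- move=> z; rewrite actD; apply: (le_trans (hM _ _)).
  rewrite expr1 -2!mulrA ler_wpM2l//; apply: le_trans (lin_le _ _) _.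
  by rewrite mulrAC.
Qed.

(** [act_le] trades the weight at [w] for the weight at [act z w], absorbed by the decay of [a], and
    for [(1 + |z|) ^+ (2 * N)], absorbed by a moment of [b]. *)
Lemma conv_rapid b a : rapid_density b -> real_schwartz a ->
  rapidly_decreasing (conv b a).
Proof.
move=> gb sa N; have [M hM] := real_schwartz_rapid sa N.
exists (M * K ^+ N * moment b (2 * N)) => w.
have w0 : 0 < (1 + `|w|) ^+ N by rewrite exprn_gt0// ltr_pwDl.
rewrite mulrC -ler_pdivlMr// mulrAC.
apply: Rintegral_mul_le => //.
  exact: (act_comp_continuous (real_schwartz_continuous sa)).
move=> z; rewrite mulrAC ler_pdivlMr// mulrC.
have h := act_le z w.
apply: (@le_trans _ _ ((K * (1 + `|act z w|) * (1 + `|z|) ^+ 2) ^+ N * `|a (act z w)|)).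
  by rewrite ler_wpM2r// lerXn2r ?nnegrE ?mulr_ge0 ?K_ge0.
rewrite exprM; move: (hM (act z w)); set A := 1 + `|act z w|; set Z := _ ^+ 2 => hA.
rewrite [leLHS](_ : _ = K ^+ N * Z ^+ N * (A ^+ N * `|a (act z w)|)); last first.
  by rewrite exprMn [(K * A) ^+ N]exprMn; ring.
rewrite [leRHS](_ : _ = K ^+ N * Z ^+ N * M); last by ring.
by rewrite ler_wpM2l ?mulr_ge0 ?exprn_ge0 ?K_ge0.
Qed.

(* The sums are needed because a derivative of a single [conv b a] is a
   combination of the [conv (b * c_k) ('D_(e_k) a)], with [c_k] affine in [z]. *)
Inductive conv_span : (E -> R) -> Prop :=
| conv_span0 : conv_span (fun=> 0)
| conv_span1 b a : rapid_density b -> real_schwartz a -> conv_span (conv b a)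
| conv_spanD f g : conv_span f -> conv_span g -> conv_span (fun x => f x + g x).

Lemma conv_span_sum (I : Type) (s : seq I) (f : I -> E -> R) :
  (forall i, conv_span (f i)) -> conv_span (fun x => \sum_(i <- s) f i x).
Proof.
move=> Sf; elim: s => [|i s IH].
  by under eq_fun do rewrite big_nil; exact: conv_span0.
by under eq_fun do rewrite big_cons; exact: conv_spanD.
Qed.

Lemma conv_span_derive f : conv_span f -> [/\ forall x v, derivable f x v,
  continuous f, rapidly_decreasing f & forall v, conv_span ('D_v f)].
Proof.
elim => [|b a gb sa|{}f g Sf [df cf rf Df] Sg [dg cg rg Dg]].
- have d0 (x v : E) : is_derive x v (fun=> 0 : R) (0 : R) by exact: is_derive_cst.
  split; [by move=> x v; have [] := d0 x v | by move=> x; exact: cvg_cst | |].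
    by move=> N; exists 0 => z; rewrite normr0 mulr0.
  move=> v; rewrite (_ : 'D_v _ = fun=> 0); first exact: conv_span0.
  by apply/funext => x; have [] := d0 x v.
- have d1 x v := is_derive_conv x v gb sa.
  split; [by move=> x v; have [] := d1 x v | | exact: conv_rapid |].
    have [L hL] := conv_lipschitz gb sa; exact: lipschitz_continuous hL.
  move=> v; rewrite (_ : 'D_v _ = fun x => \sum_k
      conv (fun z => b z * rv2_coord k (lin z v)) ('D_(rv2_basis k) a) x).
    apply: conv_span_sum => k; apply: conv_span1; first exact: rapid_density_lin.
    exact: real_schwartz_derive.
  by apply/funext => x; have [] := d1 x v.
- split.
  + by move=> x v; exact: derivableD.
  + by move=> x; exact: cvgD (cf x) (cg x).
  + exact: rapidly_decreasingD.
  + move=> v; rewrite (_ : 'D_v _ = fun x => 'D_v f x + 'D_v g x).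
      exact: conv_spanD.
    by apply/funext => x; exact: deriveD.
Qed.

Lemma conv_span_schwartz f : conv_span f -> real_schwartz f.
Proof. exact: real_schwartz_ind conv_span_derive f. Qed.

End twisted_convolution.

(** * Complex-valued integrals *)

Section normc_theory.
Context {R : realType}.
Implicit Types z : R[i].
Local Notation normc := Normc.normc.

Lemma normc_ge0 z : 0 <= normc z.
Proof. by case: z => a b; exact: sqrtr_ge0. Qed.

Lemma normcE z : normc z = Num.sqrt (complex.Re z ^+ 2 + complex.Im z ^+ 2).
Proof. by case: z. Qed.

Lemma sqr_normc z : normc z ^+ 2 = complex.Re z ^+ 2 + complex.Im z ^+ 2.
Proof. by rewrite normcE sqr_sqrtr// addr_ge0 ?sqr_ge0. Qed.

Lemma normc_ge_Re z : `|complex.Re z| <= normc z.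
Proof.
by rewrite -(ler_pXn2r (ltn0Sn 1)) ?nnegrE ?normc_ge0// sqr_normc real_normK
  ?num_real// lerDl sqr_ge0.
Qed.

Lemma normc_ge_Im z : `|complex.Im z| <= normc z.
Proof.
by rewrite -(ler_pXn2r (ltn0Sn 1)) ?nnegrE ?normc_ge0// sqr_normc real_normK
  ?num_real// lerDr sqr_ge0.
Qed.

Lemma normc_le_ReIm z : normc z <= `|complex.Re z| + `|complex.Im z|.
Proof.
rewrite -(ler_pXn2r (ltn0Sn 1)) ?nnegrE ?normc_ge0 ?addr_ge0// sqr_normc.
rewrite sqrrD !real_normK ?num_real// -addrA lerD2l lerDr.
by rewrite mulrn_wge0// mulr_ge0.
Qed.

Lemma ReM (x y : R[i]) : complex.Re (x * y) =
  complex.Re x * complex.Re y - complex.Im x * complex.Im y.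
Proof. by case: x y => a b [c d]. Qed.

Lemma ImM (x y : R[i]) : complex.Im (x * y) =
  complex.Re x * complex.Im y + complex.Im x * complex.Re y.
Proof. by case: x y => a b [c d]. Qed.

Lemma ReD (x y : R[i]) : complex.Re (x + y) = complex.Re x + complex.Re y.
Proof. by case: x y => a b [c d]. Qed.

Lemma ImD (x y : R[i]) : complex.Im (x + y) = complex.Im x + complex.Im y.
Proof. by case: x y => a b [c d]. Qed.

Lemma normc_le_add (x y : R[i]) : normc (x + y) <= normc x + normc y.
Proof.
rewrite -(ler_pXn2r (ltn0Sn 1)) ?nnegrE ?addr_ge0 ?normc_ge0// sqrrD !sqr_normc ReD ImD.
suff : complex.Re x * complex.Re y + complex.Im x * complex.Im y <= normc x * normc y.
  by nra.
apply: le_trans (ler_norm _) _.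
rewrite -(ler_pXn2r (ltn0Sn 1)) ?nnegrE ?mulr_ge0 ?normc_ge0//.
rewrite real_normK ?num_real// exprMn !sqr_normc.
(* Lagrange's identity: this square is the gap in the Cauchy-Schwarz inequality. *)
have := sqr_ge0 (complex.Re x * complex.Im y - complex.Im x * complex.Re y); nra.
Qed.

Lemma normc_cis (t : R) : normc (cis t) = 1.
Proof. by rewrite normcE /= cos2Dsin2 sqrtr1. Qed.

End normc_theory.

Lemma eq_cintegral {d} {T : measurableType d} {R : realType}
    (mu : {measure set T -> \bar R}) (D : set T) (f g : T -> R[i]) :
  f =1 g -> cintegral mu D f = cintegral mu D g.
Proof. by move/funext ->. Qed.

Section cintegral_theory.
Context {d} {T : measurableType d} {R : realType}.
Variable mu : {measure set T -> \bar R}.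
Local Notation C := R[i].
Local Notation normc := Normc.normc.
Implicit Types f g : T -> C.

Lemma cmeasurableM f g : cmeasurable f -> cmeasurable g ->
  cmeasurable (fun x => f x * g x).
Proof.
move=> [mf mf'] [mg mg']; split.
- by under eq_fun do rewrite ReM; apply: measurable_funB; exact: measurable_funM.
- by under eq_fun do rewrite ImM; apply: measurable_funD; exact: measurable_funM.
Qed.

Lemma cmeasurable_normc f : cmeasurable f -> measurable_fun [set: T] (fun x => normc (f x)).
Proof.
move=> [mf mf']; under eq_fun do rewrite normcE.
have ms : measurable_fun [set: R] (fun x : R => Num.sqrt x).
  by apply: continuous_measurable_fun; exact: sqrt_continuous.
apply: (measurableT_comp ms); apply: measurable_funD; exact: measurable_funX.
Qed.

Lemma cmeasurable_cis (h : T -> R) : measurable_fun [set: T] h ->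
  cmeasurable (fun x => cis (h x)).
Proof.
move=> mh; split => /=.
- apply: (measurableT_comp _ mh); apply: continuous_measurable_fun.
  exact: continuous_cos.
- apply: (measurableT_comp _ mh); apply: continuous_measurable_fun.
  exact: continuous_sin.
Qed.

Definition cintegrable f :=
  mu.-integrable [set: T] (fun x => (complex.Re (f x))%:E) /\
  mu.-integrable [set: T] (fun x => (complex.Im (f x))%:E).

Lemma le_cintegrable f (h : T -> R) : cmeasurable f ->
  mu.-integrable [set: T] (fun x => (h x)%:E) ->
  (forall x, normc (f x) <= h x) -> cintegrable f.
Proof.
move=> [mf mf'] ih fh; split; apply: (le_integrable measurableT _ _ ih).
- exact/measurable_EFinP.
- move=> x _ /=; rewrite lee_fin (le_trans (normc_ge_Re _))// (le_trans (fh x))//.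
  exact: ler_norm.
- exact/measurable_EFinP.
- move=> x _ /=; rewrite lee_fin (le_trans (normc_ge_Im _))// (le_trans (fh x))//.
  exact: ler_norm.
Qed.

Lemma cintegrable_normc f : cmeasurable f -> cintegrable f ->
  mu.-integrable [set: T] (fun x => (normc (f x))%:E).
Proof.
move=> mf [i1 i2].
apply: (le_integrable measurableT _ _ (integrableD measurableT
  (integrable_abse i1) (integrable_abse i2))).
- by apply/measurable_EFinP; exact: cmeasurable_normc.
- move=> x _ /=; rewrite lee_fin ger0_norm ?normc_ge0//.
  by rewrite ger0_norm ?addr_ge0// normc_le_ReIm.
Qed.

Lemma cintegrable_lty f : cmeasurable f ->
  (\int[mu]_x (normc (f x))%:E < +oo)%E -> cintegrable f.
Proof.
move=> mf h; apply: (@le_cintegrable f (fun x => normc (f x))) => //.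
apply/integrableP; split; first by apply/measurable_EFinP; exact: cmeasurable_normc.
by under eq_integral => x _ do rewrite /= ger0_norm ?normc_ge0//.
Qed.

Lemma cintegrableZl (c : C) f : cintegrable f -> cintegrable (fun x => c * f x).
Proof.
move=> [i1 i2]; split.
- apply: (eq_integrableT (integrableB measurableT
    (integrableZl measurableT (complex.Re c) i1)
    (integrableZl measurableT (complex.Im c) i2))).
  by move=> x /=; rewrite ReM.
- apply: (eq_integrableT (integrableD measurableT
    (integrableZl measurableT (complex.Re c) i2)
    (integrableZl measurableT (complex.Im c) i1))).
  by move=> x /=; rewrite ImM.
Qed.

Lemma cintegralD f g : cintegrable f -> cintegrable g ->
  cintegral mu setT (fun x => f x + g x) = cintegral mu setT f + cintegral mu setT g.
Proof.
move=> [f1 f2] [g1 g2]; rewrite /cintegral; apply/eqP; rewrite eq_complex/=.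
by rewrite -!RintegralD//; apply/andP; split; apply/eqP; apply: eq_Rintegral => x _;
  rewrite (ReD, ImD).
Qed.

(** Integrability is asked of the product because the constant will be a value of the kernel,
    possibly [0] where the integral of [f] diverges; the identity then holds with both sides [0]. *)
Lemma cintegralZl (c : C) f : cintegrable (fun x => c * f x) ->
  cintegral mu setT (fun x => c * f x) = c * cintegral mu setT f.
Proof.
have [->|c0] := eqVneq c 0.
  move=> _; rewrite mul0r /cintegral.
  under eq_Rintegral => x _ do rewrite mul0r/=.
  under [X in (_ +i* X)%C]eq_Rintegral => x _ do rewrite mul0r/=.
  by rewrite Rintegral_cst// mul0r.
move=> /(cintegrableZl c^-1).
under eq_fun do rewrite mulrA mulVf// mul1r.
move=> [i1 i2]; rewrite /cintegral; apply/eqP; rewrite eq_complex ReM ImM /=.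
have jl (r : R) h : mu.-integrable [set: T] (fun x => (h x)%:E) ->
    mu.-integrable [set: T] (EFin \o (fun x => r * h x)).
  by move=> ih; exact: (eq_integrableT (integrableZl measurableT r ih)).
rewrite -!RintegralZl// -RintegralB//; try exact: jl.
rewrite -RintegralD//; try exact: jl.
by apply/andP; split; apply/eqP; apply: eq_Rintegral => x _; rewrite (ReM, ImM).
Qed.

(** Rotation by the conjugate [u] of the integral [I]: [|I|^2] is the real part of the integral of
    [u * f], hence at most [|I|] times the integral of [|f|]. *)
Lemma normc_cintegral_le f : cmeasurable f -> cintegrable f ->
  normc (cintegral mu setT f) <= \int[mu]_x normc (f x).
Proof.
move=> mf intf; set I := cintegral mu setT f.
have [I0|I0] := eqVneq (normc I) 0.
  by rewrite I0; apply: Rintegral_ge0 => x _; exact: normc_ge0.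
have Ip : 0 < normc I by rewrite lt_def I0 normc_ge0.
pose u : C := (conjc I).
have nu : normc u = normc I by rewrite !normcE /u; case: (I) => a b /=; rewrite sqrrN.
have uI : complex.Re (u * I) = normc I ^+ 2.
  by rewrite sqr_normc ReM /u; case: (I) => a b /=; rewrite mulNr opprK !expr2.
have := cintegralZl (cintegrableZl u intf); rewrite -/I => /(congr1 (@complex.Re R)).
rewrite uI /cintegral /= => e.
rewrite -(ler_pM2l Ip) -expr2 -e -RintegralZl//; last exact: cintegrable_normc.
apply: le_Rintegral => //.
- by have [] := cintegrableZl u intf.
- exact: (eq_integrableT (integrableZl measurableT _ (cintegrable_normc mf intf))).
- move=> x _; apply: (le_trans (ler_norm _)); apply: (le_trans (normc_ge_Re _)).
  by rewrite Normc.normcM nu.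
Qed.

Lemma ae_eq_cintegral f g : cmeasurable f -> cmeasurable g ->
  {ae mu, forall x, f x = g x} -> cintegral mu setT f = cintegral mu setT g.
Proof.
move=> [f1 f2] [g1 g2] fg; rewrite /cintegral; congr (_ +i* _)%C; rewrite /Rintegral;
  congr fine; apply: ae_eq_integral => //; try exact/measurable_EFinP.
- by move: fg; apply: filterS => x -> _.
- by move: fg; apply: filterS => x -> _.
Qed.

Lemma cintegral_preserving (phi : T -> T) f : measure_preserving mu phi ->
  cmeasurable f -> cintegral mu setT (fun x => f (phi x)) = cintegral mu setT f.
Proof.
move=> hphi [f1 f2]; rewrite /cintegral /Rintegral; congr ((fine _) +i* (fine _))%C.
- by apply: (measure_preserving_integral hphi (f := fun x => (complex.Re (f x))%:E));
  exact/measurable_EFinP.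
- by apply: (measure_preserving_integral hphi (f := fun x => (complex.Im (f x))%:E));
  exact/measurable_EFinP.
Qed.

End cintegral_theory.

Lemma cmeasurable_comp {d d'} {T : measurableType d} {T' : measurableType d'} {R : realType}
    (f : T' -> R[i]) (phi : T -> T') :
  cmeasurable f -> measurable_fun [set: T] phi -> cmeasurable (fun x => f (phi x)).
Proof.
by move=> [mf mf'] mphi; split;
  [exact: (measurableT_comp mf mphi)|exact: (measurableT_comp mf' mphi)].
Qed.

(** * Integrals depending on a parameter, and Fubini for complex-valued functions *)

Section parameter_integral.
Context {d1 d2} {T1 : measurableType d1} {T2 : measurableType d2} {R : realType}.
Variable m2 : {sigma_finite_measure set T2 -> \bar R}.

(** Tonelli is applied to the positive and negative parts separately, which also covers the
    parameters where the integral diverges and [fine] returns a conventional value. Fourier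
    transforms of L^2 functions have such points. *)
Lemma measurable_Rintegral (f : T1 * T2 -> R) : measurable_fun [set: T1 * T2] f ->
  measurable_fun [set: T1] (fun x => \int[m2]_y f (x, y)).
Proof.
move=> mf; have mf' : measurable_fun [set: T1 * T2] (fun z => (f z)%:E).
  exact/measurable_EFinP.
rewrite /Rintegral; apply: measurableT_comp; first exact: fine_measurable.
under eq_fun do rewrite integralE.
apply: emeasurable_funB.
- have := measurable_integral2 m2 (measurable_funepos mf') (fun z => funepos_ge0 _ z).
  by apply: eq_measurable_fun => x _; apply: eq_integral => y _; rewrite !funeposE.
- have := measurable_integral2 m2 (measurable_funeneg mf') (fun z => funeneg_ge0 _ z).
  by apply: eq_measurable_fun => x _; apply: eq_integral => y _; rewrite !funenegE.
Qed.

Lemma cmeasurable_cintegral (f : T1 * T2 -> R[i]) : cmeasurable f ->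
  cmeasurable (fun x => cintegral m2 setT (fun y => f (x, y))).
Proof.
by move=> [mf mf']; split => /=;
  [exact: (measurable_Rintegral mf)|exact: (measurable_Rintegral mf')].
Qed.

End parameter_integral.

Section fubini.
Context {d1 d2} {T1 : measurableType d1} {T2 : measurableType d2} {R : realType}.
Variable m1 : {sigma_finite_measure set T1 -> \bar R}.
Variable m2 : {sigma_finite_measure set T2 -> \bar R}.
Local Notation normc := Normc.normc.

(** The real inner integral coincides with the extended one where the section is integrable, that
    is, almost everywhere; the outer integrals are compared on both sides through this. *)
Lemma Rintegral_fubini (f : T1 * T2 -> R) :
  (m1 \x m2)%E.-integrable [set: T1 * T2] (fun z => (f z)%:E) ->
  \int[m1]_x \int[m2]_y f (x, y) = \int[m2]_y \int[m1]_x f (x, y).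
Proof.
move=> intf; have mf : measurable_fun [set: T1 * T2] f.
  by apply/measurable_EFinP; exact: measurable_int intf.
have mfs : measurable_fun [set: T2 * T1] (fun z : T2 * T1 => f (z.2, z.1)).
  exact: (measurableT_comp mf (measurable_fun_pair measurable_snd measurable_fst)).
rewrite /Rintegral; congr fine.
transitivity (\int[m1]_x \int[m2]_y (f (x, y))%:E)%E.
  apply: ae_eq_integral => //.
  - apply/measurable_EFinP; exact: (measurable_Rintegral m2 mf).
  - exact: (measurable_fubini_F intf).
  - have := ae_integrable1 intf; apply: filterS => x ix _.
    by rewrite fineK//; exact: integrable_fin_num.
rewrite (Fubini intf); apply/esym.
apply: ae_eq_integral => //.
- apply/measurable_EFinP; exact: (measurable_Rintegral m1 mfs).
- exact: (measurable_fubini_G intf).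
- have := ae_integrable2 intf; apply: filterS => x ix _.
  by rewrite fineK//; exact: integrable_fin_num.
Qed.

Lemma cintegral_fubini (f : T1 * T2 -> R[i]) : cmeasurable f ->
  (\int[m1]_x \int[m2]_y (normc (f (x, y)))%:E < +oo)%E ->
  cintegral m1 setT (fun x => cintegral m2 setT (fun y => f (x, y))) =
  cintegral m2 setT (fun y => cintegral m1 setT (fun x => f (x, y))).
Proof.
move=> mf foo; have mn := cmeasurable_normc mf.
have [i1 i2] : cintegrable (m1 \x m2)%E f.
  apply: cintegrable_lty => //; rewrite fubini_tonelli1//.
  - exact/measurable_EFinP.
  - by move=> z; rewrite lee_fin normc_ge0.
by rewrite /cintegral /=; congr (_ +i* _)%C;
  [exact: (Rintegral_fubini i1)|exact: (Rintegral_fubini i2)].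
Qed.

End fubini.

(** * The group *)

Section measurable_rv_operations.
Context {d} {T : measurableType d} {R : realType}.

Lemma measurable_dot n (f g : T -> 'rV[R]_n) :
  measurable_fun [set: T] f -> measurable_fun [set: T] g ->
  measurable_fun [set: T] (fun x => dot (f x) (g x)).
Proof.
move=> mf mg; apply: measurable_sum => i; apply: measurable_funM.
- exact: (measurableT_comp (@measurable_coord _ R n i) mf).
- exact: (measurableT_comp (@measurable_coord _ R n i) mg).
Qed.

Lemma measurable_fun_rvZ n (a : R) (f : T -> 'rV[R]_n) :
  measurable_fun [set: T] f -> measurable_fun [set: T] (fun x => a *: f x).
Proof.
move=> mf; apply: measurable_fun_rv => i; under eq_fun do rewrite mxE.
apply: measurable_funM => //; exact: (measurableT_comp (@measurable_coord _ R n i) mf).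
Qed.

Lemma measurable_fun_rvN n (f : T -> 'rV[R]_n) :
  measurable_fun [set: T] f -> measurable_fun [set: T] (fun x => - f x).
Proof. by move=> mf; under eq_fun do rewrite -scaleN1r; exact: measurable_fun_rvZ. Qed.

End measurable_rv_operations.

Section bracket_theory.
Context {R : realType} {d p : nat} (G : htype R d p).
Local Notation V := 'rV[R]_(2 * d).
Local Notation Z := 'rV[R]_p.

Lemma bracketDl (U U' W : V) : bracket G (U + U') W = bracket G U W + bracket G U' W.
Proof. by have := bracket_linearl G W 1 U U'; rewrite !scale1r. Qed.

Lemma bracketDr (U W W' : V) : bracket G U (W + W') = bracket G U W + bracket G U W'.
Proof. by have := bracket_linearr G U 1 W W'; rewrite !scale1r. Qed.

Lemma bracket0l (W : V) : bracket G 0 W = 0.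
Proof. by apply: (addIr (bracket G 0 W)); rewrite -bracketDl !add0r. Qed.

Lemma bracket0r (U : V) : bracket G U 0 = 0.
Proof. by apply: (addIr (bracket G U 0)); rewrite -bracketDr !add0r. Qed.

Lemma bracketZl (a : R) (U W : V) : bracket G (a *: U) W = a *: bracket G U W.
Proof. by have := bracket_linearl G W a U 0; rewrite !addr0 bracket0l addr0. Qed.

Lemma bracketZr (a : R) (U W : V) : bracket G U (a *: W) = a *: bracket G U W.
Proof. by have := bracket_linearr G U a W 0; rewrite !addr0 bracket0r addr0. Qed.

Lemma bracketNr (U W : V) : bracket G U (- W) = - bracket G U W.
Proof. by rewrite -scaleN1r bracketZr scaleN1r. Qed.

Lemma bracketNl (U W : V) : bracket G (- U) W = - bracket G U W.
Proof. by rewrite -scaleN1r bracketZl scaleN1r. Qed.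

Lemma bracketC (U W : V) : bracket G U W = - bracket G W U.
Proof.
have := bracket_alt G (U + W).
rewrite bracketDl !bracketDr !bracket_alt add0r addr0 => /eqP.
by rewrite addr_eq0 => /eqP.
Qed.

Lemma bracket_sumE (U W : V) : bracket G U W =
  \sum_i \sum_j (U ord0 i * W ord0 j) *: bracket G (delta_mx ord0 i) (delta_mx ord0 j).
Proof.
rewrite {1}(row_sum_delta U) (big_morph (bracket G ^~ W) (id1 := 0) (op1 := +%R)).
- apply: eq_bigr => i _; rewrite bracketZl {1}(row_sum_delta W).
  rewrite (big_morph (bracket G _) (id1 := 0) (op1 := +%R)).
  + by rewrite scaler_sumr; apply: eq_bigr => j _; rewrite bracketZr scalerA.
  + by move=> *; exact: bracketDr.
  + exact: bracket0r.
- by move=> *; exact: bracketDl.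
- exact: bracket0l.
Qed.

Lemma bracket_le : exists2 C, 0 <= C & forall U W, `|bracket G U W| <= C * `|U| * `|W|.
Proof.
exists (\sum_i \sum_j `|bracket G (delta_mx ord0 i) (delta_mx ord0 j)|).
  by apply: sumr_ge0 => i _; apply: sumr_ge0 => j _.
move=> U W; rewrite bracket_sumE -mulrA mulr_suml.
apply: (le_trans (ler_norm_sum _ _ _)); apply: ler_sum => i _.
rewrite mulr_suml; apply: (le_trans (ler_norm_sum _ _ _)); apply: ler_sum => j _.
by rewrite normrZ mulrC ler_wpM2l// normrM ler_pM// rv_coord_le.
Qed.

Lemma measurable_bracket {dT} {T : measurableType dT} (f g : T -> V) :
  measurable_fun [set: T] f -> measurable_fun [set: T] g ->
  measurable_fun [set: T] (fun x => bracket G (f x) (g x)).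
Proof.
move=> mf mg; apply: measurable_fun_rv => k; under eq_fun do rewrite bracket_sumE summxE.
apply: measurable_sum => i; under eq_fun do rewrite summxE.
apply: measurable_sum => j; under eq_fun do rewrite mxE.
apply: measurable_funM => //; apply: measurable_funM.
- exact: (measurableT_comp (@measurable_coord _ R _ i) mf).
- exact: (measurableT_comp (@measurable_coord _ R _ j) mg).
Qed.

End bracket_theory.

Section group_theory.
Context {R : realType} {d p : nat} (G : htype R d p).
Local Notation E := ('rV[R]_(2 * d) * 'rV[R]_p)%type.

Lemma gmulA : associative (gmul G).
Proof.
move=> [x1 x2] [y1 y2] [z1 z2]; rewrite /gmul /=; congr pair; first exact: addrA.
by rewrite bracketDl bracketDr; apply/rowP => i; rewrite !mxE; ring.
Qed.

Lemma ginv_gmul (x y : E) : ginv (gmul G x y) = gmul G (ginv y) (ginv x).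
Proof.
rewrite /gmul /ginv /=; congr pair; first by rewrite opprD addrC.
rewrite bracketNl bracketNr opprK bracketC !opprD scalerN opprK; congr (_ + _).
exact: addrC.
Qed.

Lemma gmulgK (x y : E) : gmul G (gmul G x (ginv y)) y = x.
Proof.
rewrite -gmulA; case: x => x1 x2; rewrite /gmul /ginv/= !addNr bracketNl bracket_alt.
by rewrite oppr0 scaler0 !addr0 bracket0r scaler0 addr0.
Qed.

Lemma measurable_gmul {dT} {T : measurableType dT} (f g : T -> E) :
  measurable_fun [set: T] f -> measurable_fun [set: T] g ->
  measurable_fun [set: T] (fun x => gmul G (f x) (g x)).
Proof.
move=> mf mg.
have mf1 := measurableT_comp measurable_fst mf.
have mf2 := measurableT_comp measurable_snd mf.
have mg1 := measurableT_comp measurable_fst mg.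
have mg2 := measurableT_comp measurable_snd mg.
apply: measurable_fun_pair; first exact: measurable_fun_rvD.
apply: measurable_fun_rvD; first exact: measurable_fun_rvD.
exact/measurable_fun_rvZ/measurable_bracket.
Qed.

Lemma measurable_ginv {dT} {T : measurableType dT} (f : T -> E) :
  measurable_fun [set: T] f -> measurable_fun [set: T] (fun x => ginv (f x)).
Proof.
move=> mf; apply: measurable_fun_pair; apply: measurable_fun_rvN.
- exact: (measurableT_comp measurable_fst mf).
- exact: (measurableT_comp measurable_snd mf).
Qed.

Lemma haar_right_invariant (u : E) :
  measure_preserving (haar (R := R) (d := d) (p := p)) (fun x => gmul G x u).
Proof.
have -> : (fun x => gmul G x u) =
    (fun x => (x.1 + u.1, x.2 + (u.2 + 2^-1 *: bracket G x.1 u.1))).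
  by apply/funext => x; rewrite /gmul addrA.
apply: (@lebesgue_rv_shear _ _ _ u.1 (fun x => u.2 + 2^-1 *: bracket G x u.1)).
apply: measurable_fun_rvD => //; apply: measurable_fun_rvZ.
exact: measurable_bracket.
Qed.

Variable eps : R.

Definition dil (z : E) : E := (eps *: z.1, eps ^+ 2 *: z.2).

(** The quotient [w / z] of the overview, with the integration variable [z] first. *)
Definition twist (z w : E) : E := gmul G w (ginv (dil z)).

(** The linear part of the affine map [twist z]. *)
Definition twist_lin (z v : E) : E := (v.1, v.2 - (eps / 2) *: bracket G v.1 z.1).

Lemma twistE (z w : E) : twist z w =
  (w.1 - eps *: z.1, w.2 - eps ^+ 2 *: z.2 - (eps / 2) *: bracket G w.1 z.1).
Proof.
rewrite /twist /gmul /ginv /dil /= bracketNr bracketZr scalerN scalerA.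
by rewrite [2^-1 * _]mulrC.
Qed.

Lemma twistD (z w v : E) : twist z (v + w) = twist_lin z v + twist z w.
Proof.
rewrite !twistE /twist_lin; case: v w z => [v1 v2] [w1 w2] [z1 z2] /=.
apply/pair_equal_spec; split => /=; first by rewrite addrA.
by rewrite bracketDl; apply/rowP => i; rewrite !mxE; ring.
Qed.

Lemma twist_linZ (z : E) (t : R) (v : E) : twist_lin z (t *: v) = t *: twist_lin z v.
Proof.
apply/pair_equal_spec; split => //=.
by rewrite bracketZl; apply/rowP => i; rewrite !mxE; ring.
Qed.

Lemma measurable_twist {dT} {T : measurableType dT} (f g : T -> E) :
  measurable_fun [set: T] f -> measurable_fun [set: T] g ->
  measurable_fun [set: T] (fun x => twist (f x) (g x)).
Proof.
move=> mf mg; apply: measurable_gmul => //; apply: measurable_ginv.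
apply: measurable_fun_pair; apply: measurable_fun_rvZ.
- exact: (measurableT_comp measurable_fst mf).
- exact: (measurableT_comp measurable_snd mf).
Qed.

Lemma twist_continuous (w : E) : continuous (twist^~ w).
Proof.
have [C C0 hC] := bracket_le G.
apply: (@lipschitz_continuous _ _ _ _ (`|eps| + `|eps ^+ 2| + `|eps / 2| * C * `|w|)) => z v.
(* The map is affine in [z] as well, so this increment does not depend on [z]: a Lipschitz bound
   follows. *)
have -> : twist (v + z) w - twist z w =
    (- (eps *: v.1), - (eps ^+ 2 *: v.2) - (eps / 2) *: bracket G w.1 v.1).
  rewrite !twistE; apply/pair_equal_spec; split => /=; apply/rowP => i.
    by rewrite !mxE; ring.
  by rewrite bracketDr !mxE; ring.
have h1 : `|v.1| <= `|v| by rewrite prod_normE le_max lexx.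
have h2 : `|v.2| <= `|v| by rewrite prod_normE le_max lexx orbT.
have hw : `|w.1| <= `|w| by rewrite prod_normE le_max lexx.
rewrite [leLHS]prod_normE ge_max /= normrN normrZ; apply/andP; split.
  apply: (@le_trans _ _ (`|eps| * `|v|)); first by rewrite ler_wpM2l.
  by rewrite ler_wpM2r// -addrA lerDl addr_ge0// !mulr_ge0.
have hb : `|(eps / 2) *: bracket G w.1 v.1| <= `|eps / 2| * C * `|w| * `|v|.
  rewrite normrZ -!mulrA ler_wpM2l// mulrA; apply: (le_trans (hC _ _)).
  by apply: ler_pM => //; [rewrite mulr_ge0|rewrite ler_wpM2l].
have h3 : `|eps ^+ 2| * `|v.2| <= `|eps ^+ 2| * `|v| by rewrite ler_wpM2l.
have h4 : 0 <= `|eps| * `|v| by rewrite mulr_ge0.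
by apply: (le_trans (ler_normB _ _)); rewrite normrN [`|eps ^+ 2 *: _|]normrZ; lra.
Qed.

Lemma twist_lin_le : exists2 K, 0 <= K &
  forall z v, `|twist_lin z v| <= K * (1 + `|z|) * `|v|.
Proof.
have [C C0 hC] := bracket_le G; exists (1 + `|eps / 2| * C).
  by rewrite addr_ge0// mulr_ge0.
move=> z v.
have h1 : `|v.1| <= `|v| by rewrite prod_normE le_max lexx.
have h2 : `|v.2| <= `|v| by rewrite prod_normE le_max lexx orbT.
have hz : `|z.1| <= `|z| by rewrite prod_normE le_max lexx.
have D0 : 0 <= `|eps / 2| * C by rewrite mulr_ge0.
have hb : `|(eps / 2) *: bracket G v.1 z.1| <= `|eps / 2| * C * `|v| * `|z|.
  rewrite normrZ -!mulrA ler_wpM2l// mulrA; apply: (le_trans (hC _ _)).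
  by apply: ler_pM => //; [rewrite mulr_ge0|rewrite ler_wpM2l].
have n0 : 0 <= `|z| by []. have m0 : 0 <= `|v| by [].
have q0 : 0 <= `|v| * `|z| by rewrite mulr_ge0.
have r0 : 0 <= `|eps / 2| * C * `|v| by rewrite mulr_ge0.
have t0 : 0 <= `|eps / 2| * C * (`|v| * `|z|) by rewrite mulr_ge0.
rewrite [leLHS]prod_normE ge_max /=; apply/andP; split; first lra.
by apply: (le_trans (ler_normB _ _)); lra.
Qed.

Lemma twist_lin_continuous (v : E) : continuous (twist_lin^~ v).
Proof.
have [C C0 hC] := bracket_le G.
apply: (@lipschitz_continuous _ _ _ _ (`|eps / 2| * C * `|v|)) => z u.
have -> : twist_lin (u + z) v - twist_lin z v = (0, - ((eps / 2) *: bracket G v.1 u.1)).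
  apply/pair_equal_spec; split => /=; apply/rowP => i; first by rewrite !mxE; ring.
  by rewrite bracketDr !mxE; ring.
have h1 : `|v.1| <= `|v| by rewrite prod_normE le_max lexx.
have h2 : `|u.1| <= `|u| by rewrite prod_normE le_max lexx.
rewrite [leLHS]prod_normE ge_max /= normr0 normrN; apply/andP; split.
  by rewrite !mulr_ge0.
rewrite [leLHS]normrZ -!mulrA ler_wpM2l// mulrA; apply: (le_trans (hC _ _)).
by apply: ler_pM => //; [rewrite mulr_ge0|rewrite ler_wpM2l].
Qed.

(** The equation is solved for [w]: first [w.1] from [A.1] and [z.1], then [w.2], whose bracket term
    involves [w.1] again. This produces the monomials [|A| * |z|] and [|z|^2], hence the square of
    [1 + |z|]. *)
Lemma twist_growth : exists2 K, 0 <= K &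
  forall z w, 1 + `|w| <= K * (1 + `|twist z w|) * (1 + `|z|) ^+ 2.
Proof.
have [C C0 hC] := bracket_le G.
pose e := `|eps|; have e0 : 0 <= e by rewrite /e.
pose B := `|eps / 2| * C; have B0 : 0 <= B by rewrite mulr_ge0.
(* The sum of all the coefficients that occur in the bounds [w1] and [w2] below. *)
exists (1 + e + e ^+ 2 + B + B * e).
  by rewrite !addr_ge0// ?mulr_ge0 ?exprn_ge0.
move=> z w; set A := twist z w.
have z1 : `|z.1| <= `|z| by rewrite prod_normE le_max lexx.
have z2 : `|z.2| <= `|z| by rewrite prod_normE le_max lexx orbT.
have A1 : `|A.1| <= `|A| by rewrite prod_normE le_max lexx.
have A2 : `|A.2| <= `|A| by rewrite prod_normE le_max lexx orbT.
have w1 : `|w.1| <= `|A| + e * `|z|.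
  have -> : w.1 = A.1 + eps *: z.1 by rewrite /A twistE subrK.
  apply: (le_trans (ler_normD _ _)); rewrite normrZ lerD//.
  by rewrite ler_wpM2l.
have w2 : `|w.2| <= `|A| + e ^+ 2 * `|z| + B * (`|A| + e * `|z|) * `|z|.
  have -> : w.2 = A.2 + eps ^+ 2 *: z.2 + (eps / 2) *: bracket G w.1 z.1.
    by rewrite /A twistE; apply/rowP => i; rewrite /= !mxE; ring.
  apply: (le_trans (ler_normD _ _)); apply: lerD.
    apply: (le_trans (ler_normD _ _)); rewrite normrZ normrX lerD//.
    by rewrite ler_wpM2l// exprn_ge0.
  rewrite normrZ /B -!mulrA ler_wpM2l// mulrA; apply: (le_trans (hC _ _)).
  by apply: ler_pM => //; [rewrite mulr_ge0|rewrite ler_wpM2l].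
move: w1 w2; rewrite [`|w|]prod_normE -lerBrDl ge_max.
move: (`|A|) (`|z|) (normr_ge0 A) (normr_ge0 z) => a x a0 x0 w1 w2.
have ax : 0 <= a * x by rewrite mulr_ge0.
have xx : 0 <= x * x by rewrite mulr_ge0.
have axx : 0 <= a * (x * x) by rewrite mulr_ge0.
have ex : 0 <= e * x by rewrite mulr_ge0.
have -> : (1 + e + e ^+ 2 + B + B * e) * (1 + a) * (1 + x) ^+ 2 =
  (1 + e + e ^+ 2 + B + B * e) *
  (1 + a + 2 * x + 2 * (a * x) + x * x + a * (x * x)) by ring.
set P := 1 + a + _ + _ + _ + _.
(* [P] dominates [1 + a] and each of the monomials [x], [a * x], [x * x]. Multiplying by the
   coefficients beforehand leaves [lra] a problem linear in the products. *)
have P1 : 0 <= P - 1 - a by rewrite /P; lra.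
have Px : 0 <= P - x by rewrite /P; lra.
have Pax : 0 <= P - a * x by rewrite /P; lra.
have Pxx : 0 <= P - x * x by rewrite /P; lra.
have P0 : 0 <= P by rewrite /P; lra.
have k1 : 0 <= e * (P - x) by rewrite mulr_ge0.
have k2 : 0 <= e ^+ 2 * (P - x) by rewrite mulr_ge0// exprn_ge0.
have k3 : 0 <= B * (P - a * x) by rewrite mulr_ge0.
have k4 : 0 <= B * e * (P - x * x) by rewrite !mulr_ge0.
have k5 : 0 <= e * P by rewrite mulr_ge0.
have k6 : 0 <= e ^+ 2 * P by rewrite mulr_ge0// exprn_ge0.
have k7 : 0 <= B * P by rewrite mulr_ge0.
have k8 : 0 <= B * e * P by rewrite !mulr_ge0.
by apply/andP; split; [apply: (le_trans w1)|apply: (le_trans w2)]; lra.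
Qed.

End group_theory.

(** * Convolution kernels *)

Section complex_schwartz.
Context {R : realType} {E : normedModType R}.
Local Notation normc := Normc.normc.

Lemma schwartz_ReIm (f : E -> R[i]) : schwartz f <->
  real_schwartz (fun x => complex.Re (f x)) /\ real_schwartz (fun x => complex.Im (f x)).
Proof.
split=> [[[sr si] hf]|[[sr hr] [si hi]]].
- split; (split => // w N; have [M hM] := hf N w; exists M => z; apply: le_trans (hM z)).
  + by rewrite ler_wpM2l//; exact: (normc_ge_Re (iter_cderive w f z)).
  + by rewrite ler_wpM2l//; exact: (normc_ge_Im (iter_cderive w f z)).
- split => // N w; have [M hM] := hr w N; have [M' hM'] := hi w N.
  exists (M + M') => z; apply: le_trans (lerD (hM z) (hM' z)).
  by rewrite -mulrDr ler_wpM2l//; exact: (normc_le_ReIm (iter_cderive w f z)).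
Qed.

Lemma iter_cderive0 (f : E -> R[i]) x : iter_cderive [::] f x = f x.
Proof. by rewrite /iter_cderive /=; case: (f x). Qed.

Variable k : E -> E -> R[i].
Hypothesis sk : smooth_to_schwartz k.
Hypothesis ck : compactly_supported k.

Lemma kernel_schwartz x : schwartz (k x).
Proof. by have [D [<- sD _ _]] := sk; exact: sD. Qed.

Lemma kernel_near N x0 e : 0 < e ->
  \forall x \near x0, forall z, (1 + `|z|) ^+ N * normc (k x z - k x0 z) <= e.
Proof.
move=> e0; have [D [Dk _ cD _]] := sk.
have := cD [::] x0 N [::] e e0; rewrite Dk; apply: filterS => x h z.
by have := h z; rewrite iter_cderive0.
Qed.

(** Around each [x0], the bound for [k x0] plus [1] works, by continuity of [k] into the Schwartz
    space; compactness of [K] makes the bound uniform. *)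
Lemma kernel_rapid N : exists M, forall x z, (1 + `|z|) ^+ N * normc (k x z) <= M.
Proof.
have [K cK hK] := ck.
pose P (M : R) x := forall z, (1 + `|z|) ^+ N * normc (k x z) <= M.
have : \forall M \near +oo, K `<=` P M.
  apply: (compact_near_coveringP K).1 => // x0 _.
  have [_ /(_ N [::]) [M0 hM0]] := kernel_schwartz x0.
  exists ([set x | forall z, (1 + `|z|) ^+ N * normc (k x z - k x0 z) <= 1],
          [set M | M0 + 1 < M]).
    by split; [exact: kernel_near|apply: nbhs_pinfty_gt; exact: num_real].
  move=> [x M] /= [hx hM] z; apply: ltW; apply: le_lt_trans hM.
  rewrite -[k x z](subrK (k x0 z)) [k x z - _ + _]addrC.
  apply: le_trans (lerD (hM0 z) (hx z)); rewrite iter_cderive0 -mulrDr ler_wpM2l//.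
  exact: normc_le_add.
(* Outside [K], which may be empty, the kernel vanishes and the bound amounts to [0 <= M]. *)
move=> /(filterI (nbhs_pinfty_ge (num_real (0 : R)))) /filter_ex[M [M0 hM]].
exists M => x z; have [Kx|nKx] := pselect (K x); first exact: hM.
by rewrite hK// Normc.normc0 mulr0.
Qed.

(** Continuity in [x], uniform in [z], combines with continuity of [k x0] into joint continuity.
    Here [q] stands for the real or the imaginary part. *)
Lemma kernel_continuous (q : R[i] -> R) :
  (forall c c', q c - q c' = q (c - c')) -> (forall c, `|q c| <= normc c) ->
  (forall x, continuous (fun z => q (k x z))) ->
  continuous (fun xz : E * E => q (k xz.1 xz.2)).
Proof.
move=> qB qle cq [x0 z0]; apply/cvgrPdist_le => /= e e0.
have e2 : 0 < e / 2 by rewrite divr_gt0.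
have h1 : \forall x \near x0, forall z, normc (k x z - k x0 z) <= e / 2.
  by have := kernel_near 0 x0 e2; apply: filterS => x h z; have := h z; rewrite expr0 mul1r.
have h2 : \forall z \near z0, `|q (k x0 z0) - q (k x0 z)| <= e / 2.
  by have /cvgrPdist_le/(_ _ e2) := cq x0 z0.
exists ([set x | forall z, normc (k x z - k x0 z) <= e / 2],
  [set z | `|q (k x0 z0) - q (k x0 z)| <= e / 2]) => //.
move=> [x z] /= [hx hz]; rewrite -[leLHS]
  (_ : `|(q (k x0 z0) - q (k x0 z)) - (q (k x z) - q (k x0 z))| = _).
  apply: (le_trans (ler_normB _ _)); rewrite [leRHS](splitr e) lerD//.
  by rewrite qB (le_trans (qle _)).
by congr `|_|; ring.
Qed.

Lemma kernel_continuous_Re : continuous (fun xz : E * E => complex.Re (k xz.1 xz.2)).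
Proof.
apply: kernel_continuous; first by move=> [a b] [c d].
  exact: normc_ge_Re.
by move=> x; apply: real_schwartz_continuous; have /schwartz_ReIm[] := kernel_schwartz x.
Qed.

Lemma kernel_continuous_Im : continuous (fun xz : E * E => complex.Im (k xz.1 xz.2)).
Proof.
apply: kernel_continuous; first by move=> [a b] [c d].
  exact: normc_ge_Im.
by move=> x; apply: real_schwartz_continuous; have /schwartz_ReIm[] := kernel_schwartz x.
Qed.

End complex_schwartz.

(** * Complex Schwartz functions on the group and their twisted convolutions *)

Section schwartz_rv2.
Context {R : realType} {m n : nat}.
Local Notation E := ('rV[R]_m * 'rV[R]_n)%type.
Local Notation mu := (prodm (lebesgue_rv m) (lebesgue_rv n)).

Lemma real_schwartz_density (a : E -> R) : real_schwartz a -> rapid_density a.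
Proof. by move=> sa; split; [exact: real_schwartz_continuous|exact: real_schwartz_rapid]. Qed.

Lemma schwartz_cmeasurable (f : E -> R[i]) : schwartz f -> cmeasurable f.
Proof.
move=> /schwartz_ReIm[sr si]; split; apply: continuous_measurable_fun_rv2;
  exact: real_schwartz_continuous.
Qed.

Lemma schwartz_cintegrable (f : E -> R[i]) : schwartz f -> cintegrable mu f.
Proof.
by move=> /schwartz_ReIm[sr si]; split; apply: rapid_density_integrable;
  exact: real_schwartz_density.
Qed.

Lemma schwartz_bounded (f : E -> R[i]) : schwartz f ->
  exists2 M, 0 <= M & forall x, Normc.normc (f x) <= M.
Proof.
move=> [_ /(_ 0%N [::])[M hM]]; exists M.
  by apply: le_trans (hM 0); rewrite expr0 mul1r normc_ge0.
by move=> x; have := hM x; rewrite expr0 mul1r iter_cderive0.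
Qed.

Lemma continuous_measurable_fun_rv2X (f : E * E -> R) : continuous f ->
  measurable_fun [set: E * E] f.
Proof.
move=> cf; have dE := discretizable_prod (@discretizable_rv R m) (@discretizable_rv R n).
have := discretizable_measurable (discretizable_prod dE dE) cf.
by apply: eq_measurable_fun => -[[x y] [z w]].
Qed.

End schwartz_rv2.

Section twisted_convolution_schwartz.
Context {R : realType} {d p : nat} (G : htype R d p) (eps : R).
Local Notation E := ('rV[R]_(2 * d) * 'rV[R]_p)%type.
Local Notation haar := (haar (R := R) (d := d) (p := p)).

Definition twisted_conv (k f : E -> R[i]) (w : E) : R[i] :=
  cintegral haar setT (fun z => k z * f (twist G eps z w)).

Lemma twisted_conv_integrable (k f : E -> R[i]) w : schwartz k -> schwartz f ->
  cintegrable haar (fun z => k z * f (twist G eps z w)).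
Proof.
move=> sk sf; have [M M0 hM] := schwartz_bounded sf.
have mk := schwartz_cmeasurable sk.
apply: (@le_cintegrable _ _ _ _ _ (fun z => M * Normc.normc (k z))).
- apply: cmeasurableM => //.
  apply: (cmeasurable_comp (schwartz_cmeasurable sf)).
  exact: measurable_twist.
- exact: (eq_integrableT (integrableZl measurableT M
    (cintegrable_normc mk (schwartz_cintegrable sk)))).
- by move=> z; rewrite Normc.normcM mulrC ler_wpM2r// normc_ge0.
Qed.

(** The real and imaginary parts are each a sum of two real convolutions, hence in [conv_span]. The
    minus sign in the real part is carried by the density [- Im k]. *)
Lemma twisted_conv_schwartz (k f : E -> R[i]) :
  schwartz k -> schwartz f -> schwartz (twisted_conv k f).
Proof.
move=> /schwartz_ReIm[kr ki] /schwartz_ReIm[fr fi].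
have [K1 K10 hK1] := twist_lin_le G eps; have [K2 K20 hK2] := twist_growth G eps.
pose K := Num.max K1 K2.
have linle z v : `|twist_lin G eps z v| <= K * (1 + `|z|) * `|v|.
  by apply: le_trans (hK1 z v) _; rewrite ler_wpM2r// ler_wpM2r// le_max lexx.
have actle z w : 1 + `|w| <= K * (1 + `|twist G eps z w|) * (1 + `|z|) ^+ 2.
  by apply: le_trans (hK2 z w) _; rewrite ler_wpM2r// ler_wpM2r// le_max lexx orbT.
have SS := conv_span_schwartz (twistD G eps) (twist_linZ G eps) linle actle
  (@twist_continuous _ _ _ G eps) (@twist_lin_continuous _ _ _ G eps).
have int := conv_integrable (@twist_continuous _ _ _ G eps).
apply/schwartz_ReIm; split; apply: SS.
- have kiN : rapid_density (fun z => - complex.Im (k z)).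
    have [c r] := real_schwartz_density ki; split.
      by move=> z; apply: cvgN; exact: c.
    by apply: rapidly_decreasing_le r _ => z; rewrite normrN.
  rewrite (_ : (fun _ => _) = fun w =>
    conv (twist G eps) (fun z => complex.Re (k z)) (fun z => complex.Re (f z)) w +
    conv (twist G eps) (fun z => - complex.Im (k z)) (fun z => complex.Im (f z)) w).
    by apply: conv_spanD; apply: conv_span1 => //; exact: real_schwartz_density.
  apply/funext => w; rewrite /conv -RintegralD//; last 2 first.
  + exact: (int _ _ w (real_schwartz_density kr) fr).
  + exact: (int _ _ w kiN fi).
  by apply: eq_Rintegral => z _; rewrite ReM mulNr.
- rewrite (_ : (fun _ => _) = fun w =>
    conv (twist G eps) (fun z => complex.Re (k z)) (fun z => complex.Im (f z)) w +
    conv (twist G eps) (fun z => complex.Im (k z)) (fun z => complex.Re (f z)) w).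
    by apply: conv_spanD; apply: conv_span1 => //; exact: real_schwartz_density.
  apply/funext => w; rewrite /conv -RintegralD//; last 2 first.
  + exact: (int _ _ w (real_schwartz_density kr) fi).
  + exact: (int _ _ w (real_schwartz_density ki) fr).
  by apply: eq_Rintegral => z _; rewrite ImM.
Qed.

End twisted_convolution_schwartz.

(** * Boundedness on L2 *)

Section L2norm_theory.
Context {d} {T : measurableType d} {R : realType}.
Variable mu : {measure set T -> \bar R}.
Local Notation normc := Normc.normc.
Implicit Types f g : T -> R[i].

Lemma L2normE f : L2norm mu f = ((\int[mu]_x (normc (f x) ^+ 2)%:E) `^ 2^-1)%E.
Proof.
rewrite /L2norm unlock; congr poweR; apply: eq_integral => x _ /=.
by rewrite ger0_norm ?normc_ge0// powR_mulrn ?normc_ge0.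
Qed.

Lemma measurable_sqr_normc f : cmeasurable f ->
  measurable_fun [set: T] (fun x => (normc (f x) ^+ 2)%:E).
Proof.
by move=> mf; apply/measurable_EFinP; apply: measurable_funX; exact: cmeasurable_normc.
Qed.

Lemma L2_sqr_lty f : L2 mu f -> (\int[mu]_x (normc (f x) ^+ 2)%:E < +oo)%E.
Proof. by move=> [_]; rewrite L2normE; apply: lty_poweRy. Qed.

Lemma L2norm_le f g (a : R) : 0 <= a ->
  (\int[mu]_x (normc (f x) ^+ 2)%:E <= (a ^+ 2)%:E * \int[mu]_x (normc (g x) ^+ 2)%:E)%E ->
  (L2norm mu f <= a%:E * L2norm mu g)%E.
Proof.
move=> a0 h; rewrite !L2normE.
have I0 (u : T -> R[i]) : (0 <= \int[mu]_x (normc (u x) ^+ 2)%:E)%E.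
  by apply: integral_ge0 => x _; rewrite lee_fin sqr_ge0.
have -> : a%:E = ((a ^+ 2)%:E `^ 2^-1)%E :> \bar R.
  by rewrite poweR_EFin powR12_sqrt ?sqr_ge0// sqrtr_sqr ger0_norm.
rewrite -poweRM ?lee_fin ?sqr_ge0//; apply: gt0_ler_poweR => //.
- by rewrite in_itv/= I0 leey.
- by rewrite in_itv/= leey andbT mule_ge0// lee_fin sqr_ge0.
Qed.

End L2norm_theory.

(** A discriminant argument, concluded by [t = b / a]. If [b = 0], small [t] force [0 <= s]; if
    [a = 0 < b], a large [t] is contradictory. It gives Cauchy-Schwarz for the measure of density
    [M] without square roots of [M]. *)
Lemma sqr_le_of_quadratic {R : realType} (a b s : R) : 0 <= a -> 0 <= b ->
  (forall t, 0 < t -> 2 * t * b <= t ^+ 2 * a + s) -> b ^+ 2 <= a * s.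
Proof.
move=> a0 b0 H; have [bz|bn0] := eqVneq b 0.
  rewrite bz expr0n mulr_ge0// leNgt; apply/negP => s0.
  have a1 : 0 < a + 1 by rewrite ltr_wpDl.
  pose t := Num.min 1 (- s / (2 * (a + 1))).
  have t0 : 0 < t by rewrite lt_min ltr01 divr_gt0 ?oppr_gt0// mulr_gt0.
  have t1 : t <= 1 by rewrite ge_min lexx.
  have ts : t * (2 * (a + 1)) <= - s.
    by rewrite -ler_pdivlMr ?mulr_gt0// ge_min lexx orbT.
  have := H _ t0; rewrite bz; nra.
have {bn0}b0 : 0 < b by rewrite lt_def bn0.
have [az|an0] := eqVneq a 0.
  have h : 0 < (`|s| + 1) / (2 * b) by rewrite divr_gt0 ?mulr_gt0// ltr_wpDl.
  have := H _ h; rewrite az mulr0 add0r => h2.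
  have : 2 * ((`|s| + 1) / (2 * b)) * b = `|s| + 1 by field; rewrite gt_eqF.
  by move: h2 => /[swap] ->; rewrite leNgt ltr_pwDr// ler_norm.
have {an0}a0 : 0 < a by rewrite lt_def an0.
have := H _ (divr_gt0 b0 a0).
have -> : 2 * (b / a) * b = 2 * (b ^+ 2 / a) by field; rewrite gt_eqF.
have -> : (b / a) ^+ 2 * a = b ^+ 2 / a by field; rewrite gt_eqF.
move=> h; rewrite mulrC -ler_pdivrMr//; lra.
Qed.

Section kernel_operator.
Context {R : realType} {d p : nat} (G : htype R d p) (eps : R).
Local Notation E := ('rV[R]_(2 * d) * 'rV[R]_p)%type.
Local Notation haar := (haar (R := R) (d := d) (p := p)).
Local Notation normc := Normc.normc.
Local Open Scope ereal_scope.

Variables (K : E * E -> R[i]) (M : E -> R).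
Hypothesis mK : cmeasurable K.
Hypothesis mM : measurable_fun [set: E] M.
Hypothesis KM : forall x z, (normc (K (x, z)) <= M z)%R.
Hypothesis iM : haar.-integrable [set: E] (fun z => (M z)%:E).

Let a : R := (\int[haar]_z M z)%R.

Let M0 z : (0 <= M z)%R.
Proof. exact: (le_trans (normc_ge0 _) (KM z z)). Qed.

Let a0 : (0 <= a)%R.
Proof. by apply: Rintegral_ge0 => z _; exact: M0. Qed.

Let aE : \int[haar]_z (M z)%:E = a%:E.
Proof. by rewrite /a /Rintegral fineK//; exact: integrable_fin_num. Qed.

Definition kernel_op (f : E -> R[i]) (x : E) : R[i] :=
  cintegral haar setT (fun z => K (x, z) * f (twist G eps z x))%R.

Let integrand (f : E -> R[i]) : cmeasurable f ->
  cmeasurable (fun xz : E * E => K xz * f (twist G eps xz.2 xz.1))%R.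
Proof.
move=> mf; apply: cmeasurableM => //; apply: (cmeasurable_comp mf).
by apply: measurable_twist; [exact: measurable_snd|exact: measurable_fst].
Qed.

Lemma kernel_op_cmeasurable f : cmeasurable f -> cmeasurable (kernel_op f).
Proof. by move=> /integrand; exact: cmeasurable_cintegral. Qed.

(* Since [2 t |K f| <= t^2 M + M |f|^2] for all [t > 0], integrating in [z] gives
   [|kernel_op f x|^2 <= a * S f x]. *)
Let S (f : E -> R[i]) x := \int[haar]_z (M z * normc (f (twist G eps z x)) ^+ 2)%:E.

Let mS2 f : cmeasurable f -> measurable_fun [set: E * E]
  (fun xz : E * E => (M xz.2 * normc (f (twist G eps xz.2 xz.1)) ^+ 2)%:E).
Proof.
move=> mf; apply/measurable_EFinP; apply: measurable_funM.
  exact: (measurableT_comp mM measurable_snd).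
apply: measurable_funX; apply: cmeasurable_normc; apply: (cmeasurable_comp mf).
by apply: measurable_twist; [exact: measurable_snd|exact: measurable_fst].
Qed.

Let S2_ge0 f (xz : E * E) :
  0 <= (M xz.2 * normc (f (twist G eps xz.2 xz.1)) ^+ 2)%:E.
Proof. by rewrite lee_fin mulr_ge0// sqr_ge0. Qed.

Let S_ge0 f x : 0 <= S f x.
Proof. by apply: integral_ge0 => z _; exact: (S2_ge0 f (x, z)). Qed.

Let mS f : cmeasurable f -> measurable_fun [set: E] (S f).
Proof. by move=> mf; exact: (measurable_integral2 haar (mS2 mf) (S2_ge0 f)). Qed.

Let int_S f : cmeasurable f ->
  \int[haar]_x S f x = a%:E * \int[haar]_x (normc (f x) ^+ 2)%:E.
Proof.
move=> mf; rewrite /S.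
transitivity (\int[haar]_z \int[haar]_x
    (M z * normc (f (twist G eps z x)) ^+ 2)%:E).
  exact: (tonelli_swap (f := fun x z => (M z * normc (f (twist G eps z x)) ^+ 2)%:E)
    haar haar (mS2 mf) (fun x z => S2_ge0 f (x, z))).
rewrite -aE -ge0_integralZr//; last 3 first.
- exact/measurable_EFinP.
- by move=> z _; rewrite lee_fin.
- by apply: integral_ge0 => x _; rewrite lee_fin sqr_ge0.
apply: eq_integral => z _; have ms := measurable_sqr_normc mf.
under eq_integral => x _ do rewrite EFinM.
rewrite ge0_integralZl_EFin//; last 2 first.
- by move=> x _; rewrite lee_fin sqr_ge0.
- apply: (measurableT_comp ms); exact: measurable_twist.
congr (_ * _).
apply: ((haar_right_invariant G (ginv (dil eps z))).2
  (fun x => (normc (f x) ^+ 2)%:E)) => //.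
by move=> x; rewrite lee_fin sqr_ge0.
Qed.

(** [S f] has a finite integral by [int_S]. Integrability of the integrand of [kernel_op f x] is
    obtained at these [x], which is why linearity is stated almost everywhere. *)
Let S_ae_lty f : L2 haar f -> {ae haar, forall x, S f x < +oo}.
Proof.
move=> Lf; have mf := Lf.1.
have iS : haar.-integrable [set: E] (S f).
  apply/integrableP; split; first exact: mS.
  under eq_integral => x _ do rewrite gee0_abs ?S_ge0//.
  rewrite int_S// lte_mul_pinfty//.
  exact: L2_sqr_lty Lf.
have := integrable_ae measurableT iS; apply: filterS => x /(_ I) Sx.
by rewrite ltey_eq Sx.
Qed.

Let integrand1 f x : cmeasurable f ->
  cmeasurable (fun z => K (x, z) * f (twist G eps z x))%R.
Proof.
move=> mf; have mp : measurable_fun [set: E] (fun z : E => (x, z)).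
  exact: pair1_measurable.
exact: (cmeasurable_comp (integrand mf) mp).
Qed.

Let kernel_op_integrable f x : cmeasurable f -> S f x < +oo ->
  cintegrable haar (fun z => K (x, z) * f (twist G eps z x))%R /\
  haar.-integrable [set: E] (fun z => (M z * normc (f (twist G eps z x)) ^+ 2)%:E).
Proof.
move=> mf Sx.
have iS : haar.-integrable [set: E] (fun z => (M z * normc (f (twist G eps z x)) ^+ 2)%:E).
  apply/integrableP; split.
    have mp : measurable_fun [set: E] (fun z : E => (x, z)) by exact: pair1_measurable.
    exact: (measurableT_comp (mS2 mf) mp).
  by under eq_integral => z _ do rewrite gee0_abs ?(S2_ge0 f (x, z))//.
(* From [n <= 1 + n ^+ 2], the integrand is dominated by [M + M * |f|^2], both terms being
   integrable at this [x]. *)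
split => //; apply: (@le_cintegrable _ _ _ _ _
    (fun z => M z + M z * normc (f (twist G eps z x)) ^+ 2)%R).
- exact: integrand1.
- exact: (eq_integrableT (integrableD measurableT iM iS)).
- move=> z; rewrite Normc.normcM; set n := normc (f _).
  have n0 : (0 <= n)%R by exact: normc_ge0.
  apply: (@le_trans _ _ (M z * n)%R); first by rewrite ler_wpM2r.
  rewrite -{2}[M z]mulr1 -mulrDr ler_wpM2l//.
  by have := sqr_ge0 (n - 1); rewrite sqrrB; nra.
Qed.

Lemma kernel_op_linear (c : R[i]) f g : L2 haar f -> L2 haar g ->
  {ae haar, forall x, kernel_op (fun y => c * f y + g y)%R x =
     (c * kernel_op f x + kernel_op g x)%R}.
Proof.
move=> Lf Lg; have := S_ae_lty Lf; have := S_ae_lty Lg.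
apply: filterS2 => x Sg Sf.
have [jf _] := kernel_op_integrable Lf.1 Sf.
have [jg _] := kernel_op_integrable Lg.1 Sg.
rewrite /kernel_op -cintegralZl; last exact: cintegrableZl.
rewrite -cintegralD//; last exact: cintegrableZl.
by congr cintegral; apply/funext => z; ring.
Qed.

Let sqr_kernel_op_le f x : cmeasurable f -> S f x < +oo ->
  (normc (kernel_op f x) ^+ 2)%:E <= a%:E * S f x.
Proof.
move=> mf Sx; have [jf iS] := kernel_op_integrable mf Sx.
have SE : S f x = (\int[haar]_z (M z * normc (f (twist G eps z x)) ^+ 2)%R)%:E.
  by rewrite /S /Rintegral fineK//; exact: integrable_fin_num.
rewrite SE -EFinM lee_fin.
set s := (\int[haar]_z _)%R.
pose b := (\int[haar]_z normc (K (x, z) * f (twist G eps z x)))%R.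
have b0 : (0 <= b)%R by apply: Rintegral_ge0 => z _; exact: normc_ge0.
have ib := cintegrable_normc (integrand1 x mf) jf.
apply: (@le_trans _ _ (b ^+ 2)%R).
  by rewrite lerXn2r ?nnegrE ?normc_ge0//; exact: normc_cintegral_le (integrand1 x mf) jf.
apply: sqr_le_of_quadratic => // t t0.
have it : haar.-integrable [set: E] (fun z => (t ^+ 2 * M z)%:E).
  exact: (eq_integrableT (integrableZl measurableT (t ^+ 2)%R iM)).
rewrite /a /b /s -!RintegralZl// -RintegralD//.
apply: le_Rintegral => //.
- exact: (eq_integrableT (integrableZl measurableT (2 * t)%R ib)).
- exact: (eq_integrableT (integrableD measurableT it iS)).
- move=> z _; rewrite Normc.normcM; set n := normc (f _).
  have n0 : (0 <= n)%R by exact: normc_ge0.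
  apply: (@le_trans _ _ (2 * t * (M z * n))%R).
    by rewrite ler_wpM2l ?mulr_ge0 ?(ltW t0)// ler_wpM2r.
  by have := mulr_ge0 (M0 z) (sqr_ge0 (t - n)); rewrite sqrrB; lra.
Qed.

Lemma kernel_op_L2norm f : L2 haar f ->
  L2norm haar (kernel_op f) <= a%:E * L2norm haar f.
Proof.
move=> Lf; apply: L2norm_le => //.
rewrite expr2 EFinM -muleA -int_S; last exact: Lf.1.
have mSf := mS Lf.1.
rewrite -ge0_integralZl_EFin//.
apply: ae_ge0_le_integral => //.
- by move=> x _; rewrite lee_fin sqr_ge0.
- exact/measurable_sqr_normc/kernel_op_cmeasurable/Lf.1.
- by move=> x _; rewrite mule_ge0.
- exact: measurable_funeM.
- have := S_ae_lty Lf; apply: filterS => x Sx _.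
  exact: (sqr_kernel_op_le Lf.1 Sx).
Qed.

Lemma kernel_op_L2 f : L2 haar f -> L2 haar (kernel_op f).
Proof.
move=> Lf; split; first exact: kernel_op_cmeasurable Lf.1.
apply: (le_lt_trans (kernel_op_L2norm Lf)).
by rewrite lte_mul_pinfty//; case: Lf.
Qed.

(** The bounded extension is [kernel_op] itself: its formula makes sense on all of L^2, so the
    extension is explicit rather than obtained by density. *)
Lemma kernel_op_L2_bound (P : (E -> R[i]) -> Prop) (A : (E -> R[i]) -> E -> R[i]) :
  (forall f, P f -> kernel_op f =1 A f) -> L2_bound haar P A a.
Proof.
move=> BA; split => //; exists kernel_op; split.
- exact: kernel_op_L2.
- by move=> c f g Lf Lg; exact: kernel_op_linear.
- exact: kernel_op_L2norm.
- by move=> f Pf; apply/nearW => x; exact: BA.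
Qed.

End kernel_operator.

(** * Representations and Fourier transform *)

Lemma ae_preserving {d} {T : measurableType d} {R : realType}
    (mu : {measure set T -> \bar R}) (phi : T -> T) (P : T -> Prop) :
  measure_preserving mu phi -> {ae mu, forall x, P x} -> {ae mu, forall x, P (phi x)}.
Proof.
move=> [mphi hphi] [N [mN N0 PN]]; exists (phi @^-1` N); split.
- by rewrite -[X in measurable X]setTI; exact: mphi.
- have mpN : measurable (phi @^-1` N).
    by rewrite -[X in measurable X]setTI; exact: mphi.
  have mi : measurable_fun [set: T] (fun x => (\1_N x)%:E : \bar R).
    by apply/measurable_EFinP; exact: measurable_indic.
  have i0 x : (0 <= (\1_N x)%:E :> \bar R)%E by rewrite lee_fin indicE.
  have := hphi _ mi i0.
  rewrite [X in _ = X -> _](integral_indic mu measurableT mN) setIT N0 => <-.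
  rewrite (eq_integral (fun x => (\1_(phi @^-1` N) x)%:E)).
    by rewrite integral_indic// setIT.
  by move=> x _; rewrite !indicE.
- by move=> x /= nP; apply: PN.
Qed.

Section schrodinger.
Context {R : realType} {d p : nat} {G : htype R d p} (PQ : polarization G).
Local Notation C := R[i].
Local Notation E := ('rV[R]_(2 * d) * 'rV[R]_p)%type.
Local Notation haar := (haar (R := R) (d := d) (p := p)).
Local Notation normc := Normc.normc.

(** [rep] at a Schrodinger point, with the dependent type [rep_space] replaced by plain functions on
    R^d. *)
Definition srep (l : 'rV[R]_p) (x : E) (Phi : 'rV[R]_d -> C) (xi : 'rV[R]_d) : C :=
  rep PQ (pi := Schrodinger l) x Phi xi.

Definition srep_phase (l : 'rV[R]_p) (x : E) (xi : 'rV[R]_d) : R :=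
  let P := \row_j dot x.1 (basP PQ l j) in
  let Q := \row_j dot x.1 (basQ PQ l j) in
  dot l x.2 + 2^-1 * enorm l * dot P Q + Num.sqrt (enorm l) * dot xi Q.

Definition srep_shift (l : 'rV[R]_p) (x : E) : 'rV[R]_d :=
  Num.sqrt (enorm l) *: \row_j dot x.1 (basP PQ l j).

Lemma srepE l x Phi xi :
  srep l x Phi xi = cis (srep_phase l x xi) * Phi (xi + srep_shift l x).
Proof. by []. Qed.

Lemma srep_gmul l x y Phi xi : l != 0 ->
  srep l (gmul G x y) Phi xi = srep l x (srep l y Phi) xi.
Proof. by move=> l0; rewrite /srep rep_gmul. Qed.

Lemma enormZ n (t : R) (l : 'rV[R]_n) : enorm (t *: l) = `|t| * enorm l.
Proof. by rewrite /enorm dotZl dotZr mulrA -expr2 sqrtrM ?sqr_ge0// sqrtr_sqr. Qed.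

(** By [bas_ray] both parameters share the same bases, and the square root of [eps^2 * |l|] is [eps]
    times that of [|l|]. Every term of the phase and the shift then scale as under the dilation of
    [x]. *)
Lemma srep_dil l (eps : R) x Phi xi : l != 0 -> 0 < eps ->
  srep (eps ^+ 2 *: l) x Phi xi = srep l (dil eps x) Phi xi.
Proof.
move=> l0 e0; rewrite !srepE /srep_phase /srep_shift.
have [-> ->] := bas_ray PQ l0 (exprn_gt0 2 e0).
rewrite enormZ normrX (gtr0_norm e0) sqrtrM ?sqr_ge0// sqrtr_sqr (gtr0_norm e0).
have rowZ (b : 'I_d -> 'rV[R]_(2 * d)) :
    (\row_j dot (dil eps x).1 (b j) : 'rV[R]_d) = eps *: \row_j dot x.1 (b j).
  by apply/rowP => j; rewrite !mxE /dil/= dotZl.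
rewrite !rowZ scalerA [_ * eps]mulrC /dil/= !(dotZl, dotZr); congr (cis _ * _); ring.
Qed.

Lemma srep_cmeasurable {dT} {T : measurableType dT} l (u : T -> E) (Phi : 'rV[R]_d -> C)
    (xi : T -> 'rV[R]_d) :
  measurable_fun [set: T] u -> cmeasurable Phi -> measurable_fun [set: T] xi ->
  cmeasurable (fun t => srep l (u t) Phi (xi t)).
Proof.
move=> mu mPhi mxi; have m1 := measurableT_comp measurable_fst mu.
have m2 := measurableT_comp measurable_snd mu.
have mrow (b : 'I_d -> 'rV[R]_(2 * d)) :
    measurable_fun [set: T] (fun t => \row_j dot (u t).1 (b j) : 'rV[R]_d).
  apply: measurable_fun_rv => j; under eq_fun do rewrite mxE.
  exact: measurable_dot.
under eq_fun do rewrite srepE; apply: cmeasurableM.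
  apply: cmeasurable_cis; apply: measurable_funD; first apply: measurable_funD.
  - exact: measurable_dot.
  - by apply: measurable_funM => //; exact: measurable_dot.
  - by apply: measurable_funM => //; exact: measurable_dot.
apply: (cmeasurable_comp mPhi); apply: measurable_fun_rvD => //.
exact: measurable_fun_rvZ.
Qed.

Lemma normc_srep l x Phi xi : normc (srep l x Phi xi) = normc (Phi (xi + srep_shift l x)).
Proof. by rewrite srepE Normc.normcM normc_cis mul1r. Qed.

Lemma fourierE f l Phi xi : fourier PQ f (pi := Schrodinger l) Phi xi =
  cintegral haar setT (fun x => f x * srep l (ginv x) Phi xi).
Proof. by []. Qed.

Lemma fourier_cmeasurable f l (Phi : 'rV[R]_d -> C) : cmeasurable f -> cmeasurable Phi ->
  cmeasurable (fourier PQ f (pi := Schrodinger l) Phi : 'rV[R]_d -> C).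
Proof.
move=> mf mPhi.
apply: (@cmeasurable_cintegral _ _ _ _ _ haar
  (fun z : 'rV[R]_d * E => f z.2 * srep l (ginv z.2) Phi z.1)).
apply: cmeasurableM; first exact: (cmeasurable_comp mf measurable_snd).
apply: srep_cmeasurable => //; exact: measurable_ginv.
Qed.

Variables (l : 'rV[R]_p) (eps : R) (k f : E -> C) (Phi : 'rV[R]_d -> C).
Hypotheses (l0 : l != 0) (e0 : 0 < eps).
Hypotheses (sk : schwartz k) (sf : schwartz f) (LPhi : L2 (lebesgue_rv d) Phi).

Let mk := schwartz_cmeasurable sk.
Let mf := schwartz_cmeasurable sf.
Let mPhi := LPhi.1.

(** The common integrand of the two sides of [fourier_twisted_conv], in the variables [z] of [k] and
    [y] of [f]; the substitution is [y = twist G eps z w]. *)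
Let H xi (zy : E * E) : C :=
  k zy.1 * (f zy.2 * srep l (ginv (gmul G zy.2 (dil eps zy.1))) Phi xi).

Let W (zy : E * E) : R := normc (k zy.1) * normc (f zy.2).

Let mdil : measurable_fun [set: E] (dil eps : E -> E).
Proof.
by apply: measurable_fun_pair; apply: measurable_fun_rvZ;
  [exact: measurable_fst|exact: measurable_snd].
Qed.

Let mgd : measurable_fun [set: E * E] (fun zy : E * E => ginv (gmul G zy.2 (dil eps zy.1))).
Proof.
apply: measurable_ginv; apply: measurable_gmul; first exact: measurable_snd.
exact: (measurableT_comp mdil measurable_fst).
Qed.

Let mH xi : cmeasurable (H xi).
Proof.
apply: cmeasurableM; first exact: (cmeasurable_comp mk measurable_fst).
apply: cmeasurableM; first exact: (cmeasurable_comp mf measurable_snd).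
exact: srep_cmeasurable.
Qed.

Let mW : measurable_fun [set: E * E] W.
Proof.
apply: measurable_funM; apply: cmeasurable_normc.
- exact: (cmeasurable_comp mk measurable_fst).
- exact: (cmeasurable_comp mf measurable_snd).
Qed.

Let W0 zy : 0 <= W zy.
Proof. by rewrite mulr_ge0 ?normc_ge0. Qed.

Local Open Scope ereal_scope.

Let int_normc (h : E -> C) : schwartz h -> \int[haar]_x (normc (h x))%:E < +oo.
Proof.
move=> sh; have := cintegrable_normc (schwartz_cmeasurable sh) (schwartz_cintegrable sh).
move=> /integrableP[_]; under eq_integral => x _ do rewrite /= ger0_norm ?normc_ge0//.
by [].
Qed.

Let intW : \int[prodm haar haar]_zy (W zy)%:E < +oo.
Proof.
rewrite prodm_tonelli1; [|exact/measurable_EFinP|by move=> zy; rewrite lee_fin].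
rewrite /W /=; under eq_integral => z _ do under eq_integral => y _ do rewrite EFinM.
have mn (h : E -> C) : schwartz h -> measurable_fun [set: E] (fun x => (normc (h x))%:E).
  by move=> sh; apply/measurable_EFinP/cmeasurable_normc/schwartz_cmeasurable.
have I0 (h : E -> C) : 0 <= \int[haar]_x (normc (h x))%:E.
  by apply: integral_ge0 => x _; rewrite lee_fin normc_ge0.
under eq_integral => z _.
  rewrite ge0_integralZl_EFin//;
    [|by move=> y _; rewrite lee_fin normc_ge0|exact: mn|exact: normc_ge0].
  over.
rewrite ge0_integralZr//; [|exact: mn|by move=> y _; rewrite lee_fin normc_ge0].
rewrite lte_mul_pinfty//; last exact: int_normc.
by rewrite ge0_fin_numE//; exact: int_normc.
Qed.

(* Pointwise in [xi] the Fourier integral of an L^2 function may diverge; but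
   [|Phi| <= 1 + |Phi|^2], and the second term is integrable in [xi] too. *)
Let ae_intH : {ae lebesgue_rv d, forall xi,
  \int[haar]_z \int[haar]_y (normc (H xi (z, y)))%:E < +oo}.
Proof.
pose F (xi : 'rV[R]_d) (zy : E * E) : \bar R :=
  (W zy * normc (srep l (ginv (gmul G zy.2 (dil eps zy.1))) Phi xi) ^+ 2)%:E.
have F0 xi zy : 0 <= F xi zy by rewrite lee_fin mulr_ge0// sqr_ge0.
have mF : measurable_fun [set: 'rV[R]_d * (E * E)] (fun z => F z.1 z.2).
  apply/measurable_EFinP; apply: measurable_funM.
    exact: (measurableT_comp mW measurable_snd).
  apply: measurable_funX; apply: cmeasurable_normc; apply: srep_cmeasurable => //.
  exact: (measurableT_comp mgd measurable_snd).
pose J xi := \int[prodm haar haar]_zy F xi zy.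
have J0 xi : 0 <= J xi by apply: integral_ge0 => zy _; exact: F0.
have mJ : measurable_fun [set: 'rV[R]_d] J.
  exact: (measurable_integral2 (prodm haar haar) mF (fun z => F0 z.1 z.2)).
pose I := \int[lebesgue_rv d]_xi (normc (Phi xi) ^+ 2)%:E.
have I0 : 0 <= I by apply: integral_ge0 => x _; rewrite lee_fin sqr_ge0.
have mP2 := measurable_sqr_normc mPhi.
have intJ : \int[lebesgue_rv d]_xi J xi < +oo.
  rewrite /J (tonelli_swap (lebesgue_rv d) (prodm haar haar) mF F0).
  (* The representation is a phase times a translation in [xi], so the integral of its squared
     modulus is that of [Phi], whatever [zy]. *)
  rewrite (eq_integral (fun zy => (W zy)%:E * I)); last first.
    move=> zy _; rewrite /F; under eq_integral => xi _ do rewrite EFinM normc_srep.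
    set c := srep_shift _ _.
    have hc := (lebesgue_rv_translation c).2 _ mP2 (fun x => _).
    rewrite ge0_integralZl_EFin//; last 2 first.
    - by move=> x _; rewrite lee_fin sqr_ge0.
    - apply: (measurableT_comp mP2); exact: measurable_fun_rvD.
    by congr (_ * _); apply: hc => x; rewrite lee_fin sqr_ge0.
  rewrite ge0_integralZr//; [|exact/measurable_EFinP|by move=> zy _; rewrite lee_fin].
  rewrite lte_mul_pinfty//; last exact: L2_sqr_lty.
    by apply: integral_ge0 => zy _; rewrite lee_fin.
  rewrite ge0_fin_numE; first exact: intW.
  by apply: integral_ge0 => zy _; rewrite lee_fin.
have iJ : (lebesgue_rv d).-integrable [set: 'rV[R]_d] J.
  apply/integrableP; split => //.
  by under eq_integral => xi _ do rewrite gee0_abs//.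
have := integrable_ae measurableT iJ; apply: filterS => xi /(_ Logic.I) Jxi.
have mHn : measurable_fun [set: E * E] (fun zy => (normc (H xi zy))%:E).
  by apply/measurable_EFinP; apply: cmeasurable_normc; exact: mH.
have := prodm_tonelli1 haar haar mHn (fun zy => _) => <-; last first.
  by move=> zy; rewrite lee_fin normc_ge0.
have mFx : measurable_fun [set: E * E] (F xi).
  exact: (measurableT_comp mF (pair1_measurable xi)).
apply: (@le_lt_trans _ _ (\int[prodm haar haar]_zy ((W zy)%:E + F xi zy))).
  apply: ge0_le_integral => //.
  - by move=> zy _; rewrite lee_fin normc_ge0.
  - by apply: emeasurable_funD => //; exact/measurable_EFinP.
  - move=> zy _; rewrite /F -EFinD lee_fin /H; move: (srep l _ Phi xi) => r.
    rewrite !Normc.normcM mulrA -/(W zy).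
    move: (normc r) (normc_ge0 r) => n n0.
    rewrite -{2}[W zy]mulr1 -mulrDr ler_wpM2l//.
    by have := sqr_ge0 (n - 1); rewrite sqrrB; nra.
rewrite ge0_integralD//; last 2 first.
- by move=> zy _; rewrite lee_fin.
- exact/measurable_EFinP.
by rewrite lte_add_pinfty// ltey_eq Jxi.
Qed.

(** Both sides are iterated integrals of [H xi]. The left one integrates in [y] first, by [srep_dil]
    and the homomorphism property; the right one integrates in [z] first, after the
    measure-preserving substitution at fixed [z]. [ae_intH] licenses the exchange. *)
Lemma fourier_twisted_conv : {ae lebesgue_rv d, forall xi,
  fourier PQ k (pi := Schrodinger (eps ^+ 2 *: l))
    (fourier PQ f (pi := Schrodinger l) Phi) xi =
  fourier PQ (twisted_conv G eps k f) (pi := Schrodinger l) Phi xi}.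
Proof.
move: ae_intH; apply: filterS => xi Hoo.
set Psi := (fourier PQ f (pi := Schrodinger l) Phi : 'rV[R]_d -> C).
have mPsi : cmeasurable Psi by exact: fourier_cmeasurable.
have mHn : measurable_fun [set: E * E] (fun zy => (normc (H xi zy))%:E).
  by apply/measurable_EFinP; apply: cmeasurable_normc; exact: mH.
have Hn0 zy : 0 <= (normc (H xi zy))%:E by rewrite lee_fin normc_ge0.
have mHz z : cmeasurable (fun y => H xi (z, y)).
  exact: (cmeasurable_comp (mH xi) (pair1_measurable z)).
transitivity (cintegral haar setT (fun z => cintegral haar setT (fun y => H xi (z, y)))).
  rewrite fourierE; apply: ae_eq_cintegral.
  - apply: cmeasurableM => //; apply: srep_cmeasurable => //; exact: measurable_ginv.
  - exact: (cmeasurable_cintegral haar (mH xi)).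
  have mi := measurable_integral2 haar mHn Hn0.
  have i0 z : 0 <= \int[haar]_y (normc (H xi (z, y)))%:E by exact: integral_ge0.
  have iz : haar.-integrable [set: E] (fun z => \int[haar]_y (normc (H xi (z, y)))%:E).
    apply/integrableP; split => //.
    by under eq_integral => z _ do rewrite gee0_abs//.
  have := integrable_ae measurableT iz; apply: filterS => z /(_ Logic.I) Hz.
  have cz : cintegrable haar (fun y => H xi (z, y)).
    by apply: cintegrable_lty => //; rewrite ltey_eq Hz.
  have dN : dil eps (ginv z) = ginv (dil eps z) by rewrite /dil /ginv /= !scalerN.
  rewrite srep_dil// dN srepE /Psi fourierE mulrA.
  have HE y : H xi (z, y) = (k z * cis (srep_phase l (ginv (dil eps z)) xi) *
      (f y * srep l (ginv y) Phi (xi + srep_shift l (ginv (dil eps z)))))%R.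
    rewrite /H /= ginv_gmul srep_gmul// [srep l (ginv (dil _ _)) _ _]srepE.
    by ring.
  under [in RHS]eq_fun do rewrite HE.
  (* [k z] may vanish while the inner Fourier integral diverges; integrability of the product, [cz],
     is what is known. *)
  rewrite cintegralZl//; move: cz.
  by under eq_fun do rewrite HE.
(* After the substitution the dilations cancel: the representation factor depends on [w] alone and
   leaves the integral in [z], where [twisted_conv] remains. *)
have HT z w : H xi (z, twist G eps z w) =
    (srep l (ginv w) Phi xi * (k z * f (twist G eps z w)))%R.
  by rewrite /H /= /twist gmulgK; ring.
transitivity (cintegral haar setT (fun z => cintegral haar setT (fun w =>
    H xi (z, twist G eps z w)))).
  apply: eq_cintegral => z.
  by rewrite (cintegral_preserving (haar_right_invariant G (ginv (dil eps z))) (mHz z)).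
have mHT : cmeasurable (fun zw : E * E => H xi (zw.1, twist G eps zw.1 zw.2)).
  apply: (cmeasurable_comp (mH xi)); apply: measurable_fun_pair => //.
  exact: measurable_twist.
transitivity (cintegral haar setT (fun w => cintegral haar setT (fun z =>
    H xi (z, twist G eps z w)))).
  apply: (cintegral_fubini mHT).
  apply: le_lt_trans Hoo; rewrite le_eqVlt; apply/orP; left; apply/eqP.
  apply: eq_integral => z _.
  apply: ((haar_right_invariant G (ginv (dil eps z))).2
    (fun y => (normc (H xi (z, y)))%:E)) => //.
  exact: (measurableT_comp mHn (pair1_measurable z)).
rewrite fourierE; apply: eq_cintegral => w.
under eq_fun do rewrite HT.
rewrite cintegralZl; first by rewrite mulrC.
by apply: cintegrableZl; exact: twisted_conv_integrable.
Qed.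

End schrodinger.

(** * Quantization *)

Section trace_theory.
Context {d} {T : measurableType d} {R : realType}.
Variable mu : {measure set T -> \bar R}.

(** Inner products on an orthonormal basis do not see null sets, so [is_trace] is the same predicate
    for both operators and [xget] returns the same value, whether or not a trace exists. *)
Lemma eq_trace (A A' : (T -> R[i]) -> T -> R[i]) :
  (forall f, L2 mu f -> [/\ cmeasurable (A f), cmeasurable (A' f) &
    {ae mu, forall x, A f x = A' f x}]) ->
  trace mu A = trace mu A'.
Proof.
move=> AA'.
have innerE f : L2 mu f -> L2inner mu (A f) f = L2inner mu (A' f) f.
  move=> Lf; have [mA mA' h] := AA' f Lf.
  have mconj : cmeasurable (fun x => conjc (f x)).
    have [[m1 m2] _] := Lf; split.
      by apply: eq_measurable_fun m1 => x _; case: (f x).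
    rewrite (_ : (fun x => _) = (fun x => - complex.Im (f x))).
      exact: measurableT_comp.
    by apply/funext => x; case: (f x).
  apply: ae_eq_cintegral; [exact: cmeasurableM..|].
  by move: h; apply: filterS => x ->.
rewrite /trace; congr (xget _ _); apply/funext => t; apply/propext.
have seqE (q : R[i] -> R) e : orthonormal_basis mu e ->
    (fun k => q (L2inner mu (A (e k)) (e k))) = (fun k => q (L2inner mu (A' (e k)) (e k))).
  by move=> [Le _ _]; apply/funext => k; rewrite innerE.
split => h e oe; have := h e oe.
- by rewrite (seqE (@complex.Re R) e oe) (seqE (@complex.Im R) e oe).
- by rewrite -(seqE (@complex.Re R) e oe) -(seqE (@complex.Im R) e oe).
Qed.

End trace_theory.

Section quantization.
Context {R : realType} {d p : nat} {G : htype R d p} (PQ : polarization G).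
Local Notation E := ('rV[R]_(2 * d) * 'rV[R]_p)%type.
Local Notation haar := (haar (R := R) (d := d) (p := p)).
Local Notation normc := Normc.normc.

Lemma eq_plancherel_integral (c0 : R) (h h' : 'rV[R]_p -> R[i]) :
  (forall l, l != 0 -> h l = h' l) ->
  plancherel_integral (d := d) c0 h = plancherel_integral (d := d) c0 h'.
Proof.
move=> hh'; rewrite /plancherel_integral /cintegral; congr (_ * (_ +i* _)%C);
  by apply: eq_Rintegral => l; rewrite inE/= => /eqP l0; rewrite hh'.
Qed.

Lemma OpE (c0 eps : R) (sigma : symbol) (k : E -> E -> R[i]) (f : E -> R[i]) x :
  plancherel_constant PQ c0 -> convolution_kernel PQ sigma k -> 0 < eps -> schwartz f ->
  Op PQ c0 eps sigma f x = twisted_conv G eps (k x) f x.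
Proof.
move=> [_ inv] [sk _ sigmaE] e0 sf.
have skx := kernel_schwartz sk x.
have sg := twisted_conv_schwartz G eps skx sf.
(* Inversion rewrites the right-hand side, so that both sides are Plancherel integrals of traces and
   the comparison reduces to each [l != 0]. *)
rewrite (inv _ sg x); apply: eq_plancherel_integral => l l0.
apply: eq_trace => Phi LPhi.
  have el0 : eps ^+ 2 *: l != 0.
    by rewrite scaler_eq0 negb_or l0 andbT expf_neq0// gt_eqF.
  rewrite (sigmaE x (Schrodinger (eps ^+ 2 *: l)) el0).
  have mrep (Psi : 'rV[R]_d -> R[i]) : cmeasurable Psi ->
      cmeasurable (rep PQ (pi := Schrodinger l) x Psi : 'rV[R]_d -> R[i]).
    move=> mPsi; exact: (srep_cmeasurable PQ l (u := fun=> x) (xi := fun xi => xi)).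
  have mk := schwartz_cmeasurable skx; have mf := schwartz_cmeasurable sf.
  have mg := schwartz_cmeasurable sg; have mPhi := LPhi.1.
  split.
  - by apply: mrep; apply: fourier_cmeasurable => //; exact: fourier_cmeasurable.
  - by apply: mrep; exact: fourier_cmeasurable.
  (* The outer representation at [x] evaluates its argument at a shifted [xi], so the exceptional
     null set has to be translated. *)
  have := ae_preserving (lebesgue_rv_translation (srep_shift PQ l x))
    (fourier_twisted_conv PQ l0 e0 skx sf LPhi).
  by apply: filterS => xi h; rewrite -!/(srep PQ l x _ xi) !srepE h.
Qed.

(** [A0_norm] integrates an extended-real supremum. Joint continuity of the kernel makes it
    measurable; [kernel_rapid] makes it finite and rapidly decreasing, hence integrable. *)
Lemma kernel_sup (k : E -> E -> R[i]) : smooth_to_schwartz k -> compactly_supported k ->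
  exists M : E -> R, [/\ measurable_fun [set: E] M,
    forall x z, normc (k x z) <= M z,
    haar.-integrable [set: E] (fun z => (M z)%:E)
    & A0_norm k = (\int[haar]_z M z)%:E].
Proof.
move=> sk ck; pose S z := ereal_sup [set (normc (k x z))%:E | x in [set: E]].
have kS x z : ((normc (k x z))%:E <= S z)%E by apply: ereal_sup_ubound; exists x.
have S0 z : (0 <= S z)%E by apply: le_trans (kS 0 z); rewrite lee_fin normc_ge0.
have SM N : exists C : R, forall z, (S z <= (C / (1 + `|z|) ^+ N)%:E)%E.
  have [C hC] := kernel_rapid sk ck N; exists C => z.
  apply: ge_ereal_sup => _ [x _ <-]; rewrite lee_fin ler_pdivlMr ?exprn_gt0 ?ltr_pwDl//.
  by rewrite mulrC.
have Sfin z : S z \is a fin_num.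
  by have [C /(_ z) hC] := SM 0%N; rewrite ge0_fin_numE// (le_lt_trans hC)// ltry.
have SE z : S z = (fine (S z))%:E by rewrite fineK.
have cn : continuous (fun xz : E * E => normc (k xz.1 xz.2)).
  rewrite (_ : (fun xz => _) = fun xz : E * E =>
      Num.sqrt (complex.Re (k xz.1 xz.2) ^+ 2 + complex.Im (k xz.1 xz.2) ^+ 2)).
    move=> xz; apply: (@continuous_comp _ _ _ (fun xz : E * E =>
      complex.Re (k xz.1 xz.2) ^+ 2 + complex.Im (k xz.1 xz.2) ^+ 2) Num.sqrt);
      last exact: sqrt_continuous.
    apply: cvgD; apply: cvgM.
    - exact: (kernel_continuous_Re sk).
    - exact: (kernel_continuous_Re sk).
    - exact: (kernel_continuous_Im sk).
    - exact: (kernel_continuous_Im sk).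
  by apply/funext => xz; rewrite normcE.
have mS : measurable_fun [set: E] S.
  have dE := discretizable_prod (@discretizable_rv R (2 * d)) (@discretizable_rv R p).
  (* Points are re-paired to match the embedding for which [discretizable_prod] is stated. *)
  rewrite (_ : S = fun z => ereal_sup [set (normc (k (x.1, x.2) z))%:E | x in [set: E]]).
    apply: (measurable_sup_discretizable (g := fun x z => normc (k x z)) dE).
    - move=> z x; apply: (@continuous_comp _ _ _ (fun x : E => (x, z))
        (fun xz => normc (k xz.1 xz.2)));
        last exact: cn.
      exact: (cvg_pair (F := nbhs x) cvg_id (cvg_cst z)).
    - move=> x; apply: continuous_measurable_fun_rv2 => z.
      apply: (@continuous_comp _ _ _ (fun z : E => (x, z))
        (fun xz => normc (k xz.1 xz.2)));
        last exact: cn.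
      exact: (cvg_pair (F := nbhs z) (cvg_cst x) cvg_id).
  by apply/funext => z; congr ereal_sup; apply: eq_imagel => -[].
have mM : measurable_fun [set: E] (fun z => fine (S z)).
  by apply: measurableT_comp; first exact: fine_measurable.
have iM : haar.-integrable [set: E] (fun z => (fine (S z))%:E).
  apply: (rapidly_decreasing_integrable mM) => N.
  have [C hC] := SM N; exists C => z.
  have z0 : 0 < (1 + `|z|) ^+ N by rewrite exprn_gt0// ltr_pwDl.
  rewrite mulrC -ler_pdivlMr// ger0_norm ?fine_ge0//.
  by rewrite -lee_fin -SE.
exists (fun z => fine (S z)); split => //.
- by move=> x z; rewrite -lee_fin -SE.
- rewrite /A0_norm /Rintegral fineK; last exact: (integrable_fin_num measurableT iM).
  by apply: eq_integral => z _; rewrite -SE.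
Qed.

Lemma Op_L2_bound (c0 eps : R) (sigma : symbol) (k : E -> E -> R[i]) :
  plancherel_constant PQ c0 -> convolution_kernel PQ sigma k -> 0 < eps ->
  exists2 a : R, A0_norm k = a%:E & L2_bound haar schwartz (Op PQ c0 eps sigma) a.
Proof.
move=> hc0 hk e0; have [sk ck _] := hk.
have [M [mM kM iM ->]] := kernel_sup sk ck.
exists (\int[haar]_z M z) => //.
have mK : cmeasurable (fun xz : E * E => k xz.1 xz.2).
  split; apply: continuous_measurable_fun_rv2X.
  - exact: kernel_continuous_Re.
  - exact: kernel_continuous_Im.
apply: (kernel_op_L2_bound (G := G) (eps := eps) mK mM kM iM) => f sf x.
by rewrite (OpE (k := k) x hc0 hk e0 sf).
Qed.

End quantization.

Unset Implicit Arguments.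

Theorem proposition3p2 (R : realType) (d p : nat) (G : htype R d p)
    (PQ : polarization G) (c0 : R) (hc0 : plancherel_constant PQ c0) :
  (forall sigma : symbol, A0 PQ sigma ->
     forall eps : R, 0 < eps ->
       L2_bounded (haar (d := d) (p := p)) schwartz (Op PQ c0 eps sigma)) /\
  (exists2 C : R, 0 < C &
     forall (sigma : symbol) (k : 'rV[R]_(2 * d) * 'rV[R]_p ->
                                  'rV[R]_(2 * d) * 'rV[R]_p -> R[i]),
       convolution_kernel PQ sigma k ->
       forall eps : R, 0 < eps ->
         (L2_opnorm (haar (d := d) (p := p)) schwartz (Op PQ c0 eps sigma)
            <= C%:E * A0_norm k)%E).
Proof.
split=> [sigma [k hk] eps e0|].
  by have [a _ ha] := Op_L2_bound hc0 hk e0; exists a.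
exists 1; first exact: ltr01.
move=> sigma k hk eps e0; have [a -> ha] := Op_L2_bound hc0 hk e0.
by rewrite mul1e; apply: ereal_inf_lbound; exists a.
Qed.
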